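(* Fix $\theta\in(1/2,7/8]$, intervals $[\underline h,\bar h]\subset(0,1)$, $[\underline\alpha,\bar\alpha]\subset(0,1)$, $h_1\in(0,1]$ and an integer $k\ge 1$. Assume all $J_X\ge 0$ (so both GKS inequalities hold), that the $J_X$ are independent with finite second moments and $\sum_{X}\mathrm{Var}(J_X)\le Cn$ for a constant $C$ independent of $n$, and let $C_P>0$ be a constant independent of $n,h_0,h_1,\alpha$ such that $\mathbb E[(P_n(h_0,h_1,\alpha)-p_n(h_0,h_1,\alpha))^2]\le C_P/n$ for all parameters. Then for all sufficiently large $n$, $$\int_{\underline h}^{\bar h}dh_0\int_{\underline\alpha}^{\bar\alpha}d\alpha\,\mathbb E\big\langle\big(Q_k-\mathbb E\langle Q_k\rangle_{h_0,h_1,\alpha}\big)^2\big\rangle_{h_0,h_1,\alpha}\le\frac{4k^2}{(\tanh h_1)^k}\frac{\sqrt{5C_P+40}}{n^{(\theta-1/2)/3}}.$$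
   Context: Spins $\boldsymbol\sigma\in\{-1,1\}^n$, $\sigma_X=\prod_{i\in X}\sigma_i$. The couplings $J_X\ge0$, $X\subset\{1,\dots,n\}$, are independent random variables; $\tau_1,\dots,\tau_n$ are i.i.d. Poisson with mean $\alpha n^{\theta-1}$, independent of the couplings. Hamiltonian $\mathcal H(\boldsymbol\sigma)=-\sum_XJ_X\sigma_X-h_0\sum_i\sigma_i-h_1\sum_i\tau_i\sigma_i$, partition function $\mathcal Z_{h_0,h_1,\alpha}$, Gibbs expectation $\langle\cdot\rangle_{h_0,h_1,\alpha}$; for functions of $k$ replicas $\langle\cdot\rangle$ is the expectation under the product of $k$ independent copies of the Gibbs measure. $Q_k=\frac1n\sum_{i=1}^n\sigma_i^{(1)}\cdots\sigma_i^{(k)}$. Pressure $P_n=\frac1n\ln\mathcal Z_{h_0,h_1,\alpha}$, $p_n=\mathbb EP_n$, with $\mathbb E$ the expectation over all $J_X$ and $\boldsymbol\tau$. GKS inequalities: $\langle\sigma_T\rangle\ge0$ and $\langle\sigma_T\sigma_S\rangle-\langle\sigma_T\rangle\langle\sigma_S\rangle\ge0$ for all $T,S$. *)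

(* Defs.v *)
From HB Require Import structures.
From mathcomp Require Import all_boot all_order all_algebra.
From mathcomp Require Import all_classical all_reals all_analysis.
Set Implicit Arguments. Unset Strict Implicit. Unset Printing Implicit Defensive.
Import Order.TTheory GRing.Theory Num.Theory.
Local Open Scope classical_set_scope.
Local Open Scope ring_scope.

Section Defs.
Variable R : realType.

Definition tanhR (x : R) : R := (expR x - expR (- x)) / (expR x + expR (- x)).

Definition spin (b : bool) : R := if b then 1 else -1.

Variable n : nat.
Notation config := {ffun 'I_n -> bool}.

Definition sigmaX (s : config) (X : {set 'I_n}) : R := \prod_(i in X) spin (s i).

Definition hamiltonian (J : {set 'I_n} -> R) (tau : 'I_n -> R) (h0 h1 : R)
    (s : config) : R :=
  - (\sum_(X : {set 'I_n}) J X * sigmaX s X)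
  - h0 * (\sum_(i < n) spin (s i))
  - h1 * (\sum_(i < n) tau i * spin (s i)).

Definition gweight J tau h0 h1 (s : config) : R := expR (- hamiltonian J tau h0 h1 s).
Definition partition J tau h0 h1 : R := \sum_(s : config) gweight J tau h0 h1 s.

Definition pressure J tau h0 h1 : R := n%:R^-1 * ln (partition J tau h0 h1).

(** Gibbs expectation of a function of k replicas, under the product of k
    independent copies of the Gibbs measure *)
Definition gibbs_k (k : nat) J tau h0 h1 (F : {ffun 'I_k -> config} -> R) : R :=
  (\sum_(S : {ffun 'I_k -> config})
      F S * \prod_(a < k) gweight J tau h0 h1 (S a))
  / (partition J tau h0 h1) ^+ k.

Definition Qk (k : nat) (S : {ffun 'I_k -> config}) : R :=
  n%:R^-1 * \sum_(i < n) \prod_(a < k) spin (S a i).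

End Defs.
Arguments gibbs_k {R n} k J tau h0 h1 F.
Arguments Qk {R n k} S.

Section Prob.
Local Open Scope ereal_scope.
Context {d : measure_display} {T : measurableType d} {R : realType}.

Definition mutually_independent (P : probability T R) (I : finType)
    (X : I -> T -> R) : Prop :=
  forall B : I -> set R, (forall i, measurable (B i)) ->
    P (\bigcap_(i in [set: I]) (X i @^-1` B i)) = \prod_(i : I) P (X i @^-1` B i).

Definition Eb (P : probability T R) (f : T -> R) : \bar R := \int[P]_w (f w)%:E.

(** real-valued expectation (meaningful for integrable f) *)
Definition Er (P : probability T R) (f : T -> R) : R := fine (Eb P f).

Definition Var (P : probability T R) (f : T -> R) : R :=
  Er P (fun w => (f w - Er P f) ^+ 2)%R.
End Prob.

(* Main.v *)
Require Import Defs.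
From HB Require Import structures.
From mathcomp Require Import all_boot all_order all_algebra.
From mathcomp Require Import all_classical all_reals all_analysis.
From mathcomp Require Import measurable_realfun.
From mathcomp Require Import ring lra.
Import Order.TTheory GRing.Theory Num.Theory.
Local Open Scope classical_set_scope.
Local Open Scope ring_scope.

(** Since the couplings and the fields are independent and, by GKS, every site
    magnetization [m_i = <sigma_i>] is a nondecreasing function of them with
    values in [0, 1], the Harris inequality applies to nondecreasing functions of
    the [m_i].  As both [m ^ k] and [k m - m ^ k] increase on [0, 1],
    [Cov(m_i ^ k, m_j ^ k) <= k ^ 2 Cov(m_i, m_j)], and, pointwise,
    [<s_i s_j> ^ k - (m_i m_j) ^ k <= k (<s_i s_j> - m_i m_j)].  Hence the variance
    of [Q_k] is at most [k ^ 2] times that of the magnetization [Q_1].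

    For [Q_1] only the field [h0] matters.  Tilting the Gibbs measure bounds the
    thermal variance by increments of the mean magnetization in [h0]; convexity of
    the pressure and the hypothesis on its fluctuations bound the disorder
    variance by such increments plus [O(n ^ (-1/4))].  The mean magnetization is
    monotone with values in [0, 1], so its increments integrate to their step.
    The total is [O(n ^ (-1/4))], and [(theta - 1/2) / 3 <= 1/8]. *)

(** * Bounded random variables and the Harris inequality *)

(** Nothing is differentiated: derivatives in [h0] are replaced by increments over explicit field
    steps. This avoids exchanging derivatives with expectations, and on a grid of cells in [h0] the
    increments telescope. The disorder bound divides pressure fluctuations of size [n ^ (-1/2)] by a
    field step; the step [n ^ (-1/4)] makes both this quotient and the loss from the step itself of
    order [n ^ (-1/4)]. The thermal bound uses a much shorter step, which is also the width of the
    cells. Two features of the setting shape the rest. Nothing relates the fields at different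
    [alpha], so the integrand may fail to be measurable in [alpha], and the iterated integral is
    handled as a lower integral. The Poisson fields are nonnegative only almost surely, whereas GKS
    needs nonnegative couplings, so they are replaced by their positive parts. The target decays no
    faster than [n ^ (-1/8)]; for large [n] the spare factor [n ^ (1/8)] absorbs all numerical
    constants. *)

Section bounded_expectation.
Context {d : measure_display} {T : measurableType d} {R : realType}.
Implicit Types (f g : T -> R).

(** Gibbs averages are bounded uniformly in the disorder, so this class, closed under ring
    operations, settles their integrability. The pressure may be unbounded and goes through
    [integrable_of_variance]. *)
Definition bounded_measurable f :=
  measurable_fun setT f /\ exists M, forall w, `|f w| <= M.

Lemma bm_cst c : bounded_measurable (fun=> c).
Proof. by split => //; exists `|c|. Qed.

Lemma bmD f g : bounded_measurable f -> bounded_measurable g ->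
  bounded_measurable (fun w => f w + g w).
Proof.
move=> [mf [M fM]] [mg [N gN]]; split; first exact: measurable_funD.
by exists (M + N) => w; rewrite (le_trans (ler_normD _ _))// lerD.
Qed.

Lemma bmM f g : bounded_measurable f -> bounded_measurable g ->
  bounded_measurable (fun w => f w * g w).
Proof.
move=> [mf [M fM]] [mg [N gN]]; split; first exact: measurable_funM.
by exists (M * N) => w; rewrite normrM ler_pM.
Qed.

Lemma bmB f g : bounded_measurable f -> bounded_measurable g ->
  bounded_measurable (fun w => f w - g w).
Proof.
move=> bf [mg [N gN]]; apply: bmD => //; split; first exact: measurable_funN.
by exists N => w; rewrite normrN.
Qed.

Lemma bmX f n : bounded_measurable f -> bounded_measurable (fun w => f w ^+ n).
Proof.
move=> [mf [M fM]]; split; first exact: measurable_funX.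
by exists (M ^+ n) => w; rewrite normrX lerXn2r ?nnegrE//; apply: le_trans (fM w).
Qed.

Lemma bm_sum (I : Type) (r : seq I) (h : I -> T -> R) :
  (forall i, bounded_measurable (h i)) ->
  bounded_measurable (fun w => \sum_(i <- r) h i w).
Proof.
move=> bh; elim: r => [|i r IH].
  by under eq_fun do rewrite big_nil; exact: bm_cst.
by under eq_fun do rewrite big_cons; exact: bmD.
Qed.

Variable P : probability T R.

Lemma bm_integrable f : bounded_measurable f -> P.-integrable setT (EFin \o f).
Proof.
move=> [mf [M fM]]; apply: measurable_bounded_integrable => //.
  by rewrite (le_lt_trans (probability_le1 P measurableT))// ltry.
exists M; split; first exact: num_real.
by move=> x Mx w _; apply: le_trans (ltW Mx); exact: fM.
Qed.

Lemma Er_Eb f : P.-integrable setT (EFin \o f) -> Eb P f = (Er P f)%:E.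
Proof. by move=> fi; rewrite /Er fineK// /Eb; exact: integrable_fin_num. Qed.

Lemma Er_cst (c : R) : Er P (fun=> c) = c.
Proof. by rewrite /Er /Eb integral_cst//= probability_setT mule1. Qed.

Lemma ErD f g : P.-integrable setT (EFin \o f) ->
  P.-integrable setT (EFin \o g) ->
  Er P (fun w => f w + g w) = Er P f + Er P g.
Proof. exact: RintegralD. Qed.

Lemma ErB f g : P.-integrable setT (EFin \o f) ->
  P.-integrable setT (EFin \o g) ->
  Er P (fun w => f w - g w) = Er P f - Er P g.
Proof. exact: RintegralB. Qed.

Lemma ErZ (c : R) f : P.-integrable setT (EFin \o f) ->
  Er P (fun w => c * f w) = c * Er P f.
Proof. exact: RintegralZl. Qed.

Lemma le_Er f g : P.-integrable setT (EFin \o f) ->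
  P.-integrable setT (EFin \o g) -> (forall w, f w <= g w) -> Er P f <= Er P g.
Proof. by move=> fi gi fg; exact: le_Rintegral. Qed.

Lemma Er_sum (I : Type) (r : seq I) (h : I -> T -> R) :
  (forall i, bounded_measurable (h i)) ->
  Er P (fun w => \sum_(i <- r) h i w) = \sum_(i <- r) Er P (h i).
Proof.
move=> bh; elim: r => [|i r IH].
  by under eq_fun do rewrite big_nil; rewrite Er_cst big_nil.
under eq_fun do rewrite big_cons.
by rewrite ErD ?big_cons ?IH//; apply: bm_integrable => //; exact: bm_sum.
Qed.

Lemma ae_eq_Eb f g : measurable_fun setT f -> measurable_fun setT g ->
  (\forall w \ae P, f w = g w) -> Eb P f = Eb P g.
Proof.
move=> mf mg fg; apply: ae_eq_integral => //; try exact/measurable_EFinP.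
by apply: filterS fg => w -> _.
Qed.

Lemma ae_eq_Er f g : measurable_fun setT f -> measurable_fun setT g ->
  (\forall w \ae P, f w = g w) -> Er P f = Er P g.
Proof. by move=> mf mg fg; rewrite /Er (ae_eq_Eb _ _ mf mg fg). Qed.

End bounded_expectation.
#[global] Hint Resolve bm_cst : core.

Section product_expectation.
Context {d : measure_display} {T : measurableType d} {R : realType}.
Variable P : probability T R.

Definition self_product : set (T * T) -> \bar R := (P \x P)%E.
HB.instance Definition _ := Measure.on self_product.

Let self_product_setT : self_product setT = 1%E.
Proof.
by rewrite /self_product -setXTT product_measure1E//= probability_setT mule1.
Qed.
HB.instance Definition _ :=
  Measure_isProbability.Build _ _ _ self_product self_product_setT.

Lemma Er_self_product (F : T * T -> R) : bounded_measurable F ->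
  Er self_product F = Er P (fun w => Er P (fun w' => F (w, w'))).
Proof.
move=> bF; have [mF [M FM]] := bF.
have iF : (P \x P)%E.-integrable setT (EFin \o F).
  exact: (bm_integrable self_product).
rewrite {1}/Er /Eb -(integral12_prod_meas1 iF) /Er /Eb; congr fine.
apply: eq_integral => w _; rewrite /fubini_F /=.
rewrite fineK//; apply: (@integrable_fin_num _ _ _ _ setT) => //.
apply: (bm_integrable P (fun w' => F (w, w'))); split; last by exists M.
exact: measurableT_comp.
Qed.

End product_expectation.

(** * Joint laws are determined by boxes *)

Section same_law.
Context {R : realType} {I : finType}.

(** Testing against every measurable family can be checked by composition; the coordinate family on
    the box sigma-algebra gives back ordinary measurability. *)
Definition cyl_measurable (F : (I -> R) -> R) :=
  forall d (T : measurableType d) (Y : I -> T -> R),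
    (forall i, measurable_fun setT (Y i)) ->
    measurable_fun setT (fun w => F (Y^~ w)).

(* An alias carrying a pointed structure, which [g_sigma_algebraType] needs. *)
Definition coordinates : Type := I -> R.
HB.instance Definition _ := Choice.on coordinates.
HB.instance Definition _ := isPointed.Build coordinates (fun=> 0).

Definition boxes : set (set coordinates) :=
  [set [set x : coordinates | forall i, B i (x i)] |
    B in [set B : I -> set R | forall i, measurable (B i)]].

Local Notation W := (g_sigma_algebraType boxes).

(** Uniqueness of measures on a pi-system: boxes are stable under intersection and contain the whole
    space, so the two joint laws agree on the sigma-algebra they generate. Both expectations are
    integrals of [F] against this common law. *)
Lemma boxes_same_law d1 (T1 : measurableType d1) (P1 : probability T1 R)
  d2 (T2 : measurableType d2) (P2 : probability T2 R)
  (Y1 : I -> T1 -> R) (Y2 : I -> T2 -> R) (F : (I -> R) -> R) (M : R) :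
  (forall i, measurable_fun setT (Y1 i)) ->
  (forall i, measurable_fun setT (Y2 i)) ->
  (forall B : I -> set R, (forall i, measurable (B i)) ->
    P1 (\bigcap_(i in [set: I]) (Y1 i @^-1` B i)) =
    P2 (\bigcap_(i in [set: I]) (Y2 i @^-1` B i))) ->
  cyl_measurable F -> (forall x, `|F x| <= M) ->
  Er P1 (fun w => F (Y1^~ w)) = Er P2 (fun w => F (Y2^~ w)).
Proof.
move=> m1 m2 e12 mF FM.
have mY d (T : measurableType d) (Y : I -> T -> R) :
    (forall i, measurable_fun setT (Y i)) ->
    measurable_fun setT ((fun w => Y^~ w) : T -> W).
  move=> mYi; apply: (@measurability _ _ T W setT _ boxes (erefl _)) => _ [_ [B mB <-] <-].
  rewrite setTI [X in measurable X](_ : _ = \bigcap_(i in [set: I]) (Y i @^-1` B i)).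
    apply: fin_bigcap_measurable => [|i _]; first exact: finite_finset.
    by rewrite -[X in measurable X]setTI; exact: mYi.
  by apply/seteqP; split => w /= h i; [move=> _; exact: h|exact: h].
have mFW : measurable_fun setT (F : W -> R).
  apply: (mF _ W (fun i (x : W) => x i)) => i _ A mA; rewrite setTI.
  apply: sub_sigma_algebra; exists (fun j => if j == i then A else setT).
    by move=> j /=; case: ifP.
  apply/seteqP; split => x /=; first by move/(_ i); rewrite eqxx.
  by move=> Ax j; case: eqP => [->|].
pose XY d (T : measurableType d) (Y : I -> T -> R)
    (mYi : forall i, measurable_fun setT (Y i)) : {mfun T >-> (W : measurableType _)} :=
  HB.pack ((fun w => Y^~ w) : T -> W) (isMeasurableFun.Build _ _ _ _ _ (mY _ _ _ mYi)).
have key d (T : measurableType d) (P : probability T R) (Y : I -> T -> R)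
    (mYi : forall i, measurable_fun setT (Y i)) :
    Er P (fun w => F (Y^~ w)) =
    fine (\int[distribution P (XY _ _ _ mYi)]_(x in setT) (F x)%:E).
  congr fine; rewrite integral_pushforward//.
  - exact/measurable_EFinP.
  - apply: (bm_integrable P (fun w => F (Y^~ w))).
    by split; [exact: mF|exists M].
rewrite (key _ _ _ _ m1) (key _ _ _ _ m2); congr fine.
apply: eq_measure_integral => A mA _.
have boxE d (T : measurableType d) (Y : I -> T -> R) (B : I -> set R) :
  (fun w => Y^~ w) @^-1` [set x : coordinates | forall i, B i (x i)] =
    \bigcap_(i in [set: I]) (Y i @^-1` B i).
  by apply/seteqP; split => w /= h i; [move=> _; exact: h|exact: h].
pose proof (@measure_unique _ R W boxes (fun=> setT) (erefl _)) as mu0. apply: mu0 => //.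
- move=> _ _ [B mB <-] [C mC <-]; exists (fun i => B i `&` C i).
    by move=> i; exact: measurableI.
  by apply/seteqP; split => x /= => [h|[h1 h2] i]; [split => i; have [] := h i|split].
- move=> _; exists (fun=> setT); first by move=> ?; exact: measurableT.
  by apply/seteqP; split.
- by rewrite bigcup_const//; exists 0%N.
- by move=> _ [B mB <-]; have := e12 _ mB; rewrite -!boxE.
- by move=> _; rewrite (le_lt_trans (probability_le1 _ measurableT))// ltry.
Qed.
End same_law.

(** * The Harris inequality, by exchanging coordinates between two independent copies *)

Section harris.
Context {d : measure_display} {T : measurableType d} {R : realType}.
Context {I : finType}.
Variables (P : probability T R) (X : I -> T -> R).
Hypothesis mX : forall i, measurable_fun setT (X i).
Hypothesis iX : mutually_independent P X.

Let mbig (J : finType) d' (T' : measurableType d') (Y : J -> T' -> R)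
  (B : J -> set R) : (forall j, measurable_fun setT (Y j)) ->
  (forall j, measurable (B j)) ->
  measurable (\bigcap_(j in [set: J]) (Y j @^-1` B j)).
Proof.
move=> mY mB; apply: fin_bigcap_measurable => [|j _]; first exact: finite_finset.
by rewrite -[X in measurable X]setTI; exact: mY.
Qed.

Definition two_copies (j : I + I) (w : T * T) : R :=
  match j with inl i => X i w.1 | inr i => X i w.2 end.

Definition swap (i0 : I) (j : I + I) : I + I :=
  match j with
  | inl i => if i == i0 then inr i else inl i
  | inr i => if i == i0 then inl i else inr i
  end.

Let swapK i0 : involutive (swap i0).
Proof. by case=> i /=; case: ifP => //= ->. Qed.

Let two_copies_measurable j : measurable_fun setT (two_copies j).
Proof.
by case: j => i; [exact: (measurableT_comp (mX i) measurable_fst)|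
                  exact: (measurableT_comp (mX i) measurable_snd)].
Qed.

Let two_copies_box (B : I + I -> set R) : (forall j, measurable (B j)) ->
  self_product P (\bigcap_(j in [set: I + I]) (two_copies j @^-1` B j)) =
  (\prod_(i : I) (P (X i @^-1` B (inl i)) * P (X i @^-1` B (inr i))))%E.
Proof.
move=> mB; rewrite [X in self_product P X](_ : _ =
  (\bigcap_(i in [set: I]) (X i @^-1` B (inl i))) `*`
  (\bigcap_(i in [set: I]) (X i @^-1` B (inr i)))); last first.
  apply/seteqP; split => -[w1 w2] /= h.
    by split => i _; [exact: (h (inl i))|exact: (h (inr i))].
  by move=> [i|i] _; [exact: h.1|exact: h.2].
have mBl i : measurable (B (inl i)) by exact: mB.
have mBr i : measurable (B (inr i)) by exact: mB.
rewrite /self_product product_measure1E; [|exact: mbig..].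
by rewrite big_split; congr (_ * _)%E; exact: iX.
Qed.

(** By independence a box has a probability that factors over the coordinates, and exchanging the
    two copies of [i0] only permutes two of the factors. *)
Let swap_law i0 (F : (I + I -> R) -> R) (M : R) : cyl_measurable F ->
  (forall x, `|F x| <= M) ->
  Er (self_product P) (fun w => F (two_copies^~ w)) =
  Er (self_product P) (fun w => F (fun j => two_copies (swap i0 j) w)).
Proof.
move=> mF FM; apply: (boxes_same_law _ _ _ _ _ _
  two_copies (fun j => two_copies (swap i0 j)) F M) => // B mB.
rewrite [X in _ = _ X](_ : _ =
  \bigcap_(j in [set: I + I]) (two_copies j @^-1` B (swap i0 j))); last first.
  apply/seteqP; split => w /= h j _; have := h (swap i0 j) Logic.I;
    by rewrite /= swapK.
have mB' j : measurable (B (swap i0 j)) by exact: mB.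
apply: etrans (two_copies_box B mB) (etrans _ (esym (two_copies_box _ mB'))).
apply: eq_bigr => i _ /=.
by case: ifP => //; rewrite muleC.
Qed.

Let hybrid (s : seq I) (x : I + I -> R) (i : I) : R :=
  if i \in s then x (inr i) else x (inl i).

(** Let [f] read the first copy and [g] the hybrid configuration. Moving the coordinates of [g] one
    by one to the second copy leads from the expectation of the product to the product of
    expectations, and no move increases the value. *)
Theorem harris (f g : (I -> R) -> R) (M N : R) :
  cyl_measurable f -> cyl_measurable g ->
  (forall x, `|f x| <= M) -> (forall x, `|g x| <= N) ->
  (forall x y, (forall i, x i <= y i) -> f x <= f y) ->
  (forall x y, (forall i, x i <= y i) -> g x <= g y) ->
  Er P (fun w => f (X^~ w)) * Er P (fun w => g (X^~ w)) <=
  Er P (fun w => f (X^~ w) * g (X^~ w)).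
Proof.
move=> mf mg fM gN f_incr g_incr.
pose PP := self_product P.
pose f0 (x : I + I -> R) := f (fun i => x (inl i)).
pose gs s (x : I + I -> R) := g (hybrid s x).
have mf0 : cyl_measurable f0.
  by move=> d' T' Y mY; apply: (mf _ _ (fun i => Y (inl i))).
have mgs s : cyl_measurable (gs s).
  move=> d' T' Y mY; rewrite /gs /hybrid.
  apply: (mg _ _ (fun i w => if i \in s then Y (inr i) w else Y (inl i) w)).
  by move=> i; case: (i \in s).
have bm_two (F : (I + I -> R) -> R) K : cyl_measurable F ->
    (forall x, `|F x| <= K) -> bounded_measurable (fun w => F (two_copies^~ w)).
  by move=> mF FK; split; [exact: mF|exists K].
have bf0 : bounded_measurable (fun w => f0 (two_copies^~ w)).
  by apply: (bm_two f0 M) => // x; exact: fM.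
have bgs s : bounded_measurable (fun w => gs s (two_copies^~ w)).
  by apply: (bm_two (gs s) N) => // x; exact: gN.
have step s i0 : Er PP (fun w => f0 (two_copies^~ w) * gs (i0 :: s) (two_copies^~ w)) <=
    Er PP (fun w => f0 (two_copies^~ w) * gs s (two_copies^~ w)).
  have [i0s|i0s] := boolP (i0 \in s).
    suff -> : gs (i0 :: s) = gs s by [].
    apply/funext => x; congr g; apply/funext => i; rewrite /hybrid inE.
    by case: eqP => // ->; rewrite i0s.
  pose F x := f0 x * (gs s x - gs (i0 :: s) x).
  have mF : cyl_measurable F.
    move=> d' T' Y mY; apply: measurable_funM; first exact: mf0.
    by apply: measurable_funB; exact: mgs.
  have FM x : `|F x| <= M * (N + N).
    rewrite normrM ler_pM// ?(le_trans (ler_normB _ _))// ?lerD//; exact: gN || exact: fM.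
  have eF := swap_law i0 F (M * (N + N)) mF FM.
  have swapF w : F (fun j => two_copies (swap i0 j) w) =
      f0 (fun j => two_copies (swap i0 j) w) *
      (gs (i0 :: s) (two_copies^~ w) - gs s (two_copies^~ w)).
    rewrite /F; congr (_ * (g _ - g _)); apply/funext => i; rewrite /hybrid inE /=;
    by case: (eqVneq i i0) => [->|ii0] /=; rewrite ?eqxx ?(negbTE i0s) ?(negbTE ii0).
  suff F0 : 0 <= Er PP (fun w => F (two_copies^~ w)).
    rewrite -subr_ge0 -ErB; try by apply: bm_integrable; exact: bmM.
    by apply: le_trans F0 _; rewrite /F le_eqVlt; apply/orP; left; apply/eqP;
      congr (Er PP _); apply/funext => w; rewrite mulrBr.
  have bF : bounded_measurable (fun w => F (two_copies^~ w)) by exact: bm_two FM.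
  have bF' : bounded_measurable (fun w => F (fun j => two_copies (swap i0 j) w)).
    split; last by exists (M * (N + N)).
    by apply: (mF _ _ (fun j => two_copies (swap i0 j))).
  (* Averaging [F] with its swapped version yields a product of an increment of [f] and an increment
     of [g], both with the sign of [X i0 w.1 - X i0 w.2]. *)
  suff : 0 <= Er PP (fun w => F (two_copies^~ w)) +
              Er PP (fun w => F (two_copies^~ w)) by lra.
  rewrite {2}eF -ErD; try exact: bm_integrable.
  apply: Rintegral_ge0 => w _; rewrite swapF /F -[_ - gs s _]opprB mulrN -mulrBl.
  have [le12|/ltW le21] := leP (X i0 w.1) (X i0 w.2).
    apply: mulr_le0; rewrite subr_le0.
      apply: f_incr => i /=; case: (eqVneq i i0) => [->|]//.
    apply: g_incr => i; rewrite /hybrid inE /=.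
    by case: (eqVneq i i0) => [->|]//=; rewrite (negbTE i0s).
  apply: mulr_ge0; rewrite subr_ge0.
    apply: f_incr => i /=; case: (eqVneq i i0) => [->|]//.
  apply: g_incr => i; rewrite /hybrid inE /=.
  by case: (eqVneq i i0) => [->|]//=; rewrite (negbTE i0s).
have all_s s : Er PP (fun w => f0 (two_copies^~ w) * gs s (two_copies^~ w)) <=
    Er PP (fun w => f0 (two_copies^~ w) * gs [::] (two_copies^~ w)).
  by elim: s => // i s IH; exact: le_trans (step s i) IH.
have bX (F : (I -> R) -> R) K : cyl_measurable F -> (forall x, `|F x| <= K) ->
    bounded_measurable (fun w => F (X^~ w)).
  by move=> mF FK; split; [exact: mF|exists K].
(* At [enum I] the arguments of [f] and [g] are independent; at [[::]] they coincide. *)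
have := all_s (enum I); rewrite !Er_self_product; try exact: bmM.
set a := Er P _; set b := Er P _; suff [-> ->] : 
  a = Er P (fun w => f (X^~ w)) * Er P (fun w => g (X^~ w)) /\
  b = Er P (fun w => f (X^~ w) * g (X^~ w)) by [].
split; last first.
  congr (Er P _); apply/funext => w.
  exact: (Er_cst P (f (X^~ w) * g (X^~ w))).
rewrite mulrC -ErZ; last by apply: bm_integrable; exact: bX fM.
congr (Er P _); apply/funext => w; rewrite mulrC -ErZ; last first.
  by apply: bm_integrable; exact: bX gN.
congr (Er P _); apply/funext => w'; congr (_ * g _).
by apply/funext => i; rewrite /hybrid mem_enum.
Qed.

End harris.

(** * Averages with respect to a positive weight *)

Section weighted_average.
Context {R : realType} {S : finType}.
Implicit Types (W f g q phi : S -> R).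

Definition avg W f := (\sum_s f s * W s) / \sum_s W s.

Variables (s0 : S) (W : S -> R).
Hypothesis W_gt0 : forall s, 0 < W s.

Lemma sum_weight_gt0 : 0 < \sum_s W s.
Proof.
rewrite (bigD1 s0)//= ltr_pwDl// sumr_ge0// => s _; exact: ltW.
Qed.

Lemma avg_cst c : avg W (fun=> c) = c.
Proof. by rewrite /avg -mulr_sumr mulfK// gt_eqF// sum_weight_gt0. Qed.

Lemma avgD f g : avg W (fun s => f s + g s) = avg W f + avg W g.
Proof.
rewrite /avg -mulrDl -big_split/=; congr (_ / _).
by apply: eq_bigr => s _; rewrite mulrDl.
Qed.

Lemma avgZ c f : avg W (fun s => c * f s) = c * avg W f.
Proof.
rewrite /avg mulrA mulr_sumr; congr (_ / _).
by apply: eq_bigr => s _; rewrite mulrA.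
Qed.

Lemma avgB f g : avg W (fun s => f s - g s) = avg W f - avg W g.
Proof.
rewrite -[- avg W g]mulN1r -avgZ -avgD; congr avg.
by apply/funext => s; rewrite mulN1r.
Qed.

Lemma avg_sum (I : Type) (r : seq I) (F : I -> S -> R) :
  avg W (fun s => \sum_(i <- r) F i s) = \sum_(i <- r) avg W (F i).
Proof.
elim: r => [|i r IH].
  by rewrite big_nil -[RHS](avg_cst 0); congr avg; apply/funext => s; rewrite big_nil.
rewrite big_cons -IH -avgD; congr avg.
by apply/funext => s; rewrite big_cons.
Qed.

Lemma le_avg f g : (forall s, f s <= g s) -> avg W f <= avg W g.
Proof.
move=> fg; rewrite ler_pM2r ?invr_gt0 ?sum_weight_gt0//.
by apply: ler_sum => s _; rewrite ler_wpM2r// ltW.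
Qed.

Lemma avg_bounds (a b : R) f : (forall s, a <= f s <= b) -> a <= avg W f <= b.
Proof.
move=> fab; apply/andP; split.
  by rewrite -(avg_cst a); apply: le_avg => s; have /andP[] := fab s.
by rewrite -(avg_cst b); apply: le_avg => s; have /andP[] := fab s.
Qed.

Lemma avg_norm_le (M : R) f : (forall s, `|f s| <= M) -> `|avg W f| <= M.
Proof. by move=> fM; rewrite ler_norml avg_bounds// => s; rewrite -ler_norml. Qed.

Lemma avg_tilt phi f :
  avg (fun s => W s * expR (phi s)) f =
  avg W (fun s => f s * expR (phi s)) / avg W (fun s => expR (phi s)).
Proof.
have Z0 : (\sum_s W s) != 0 by rewrite gt_eqF// sum_weight_gt0.
rewrite /avg invf_div mulrA mulfVK//.
by congr (_ / _); apply: eq_bigr => s _; ring.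
Qed.

(* Jensen's inequality, from [expR x >= 1 + x] at [x = phi s - avg phi]. *)
Lemma avg_le_ln_ratio phi :
  avg W phi <= ln (\sum_s W s * expR (phi s)) - ln (\sum_s W s).
Proof.
have Z0 := sum_weight_gt0.
have E0 s : 0 < W s * expR (phi s) by rewrite mulr_gt0 ?expR_gt0.
have Z1 : 0 < \sum_s W s * expR (phi s).
  by rewrite (bigD1 s0)//= ltr_pwDl// sumr_ge0// => s _; exact: ltW.
rewrite -ln_div ?posrE// -ler_expR lnK ?posrE ?divr_gt0//.
have -> : (\sum_s W s * expR (phi s)) / (\sum_s W s) = avg W (fun s => expR (phi s)).
  by congr (_ / _); apply: eq_bigr => s _; rewrite mulrC.
rewrite -[leLHS]mulr1.
have {1}-> : 1 = avg W (fun s => 1 + (phi s - avg W phi)).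
  by rewrite avgD avgB !avg_cst subrr addr0.
rewrite -avgZ; apply: le_avg => s.
rewrite -ler_pdivlMl ?expR_gt0// -expRN -expRD [- _ + _]addrC.
exact: expR_ge1Dx.
Qed.

(** The slope of [expR (a * x)] on [-1, 1] is at least [a * expR (- a)]; [expR u >= 1 + u] replaces
    the mean value theorem. *)
Lemma expR_chord (a x y : R) : 0 <= a -> -1 <= x <= 1 -> -1 <= y <= 1 ->
  a * expR (- a) * (x - y) ^+ 2 <= (x - y) * (expR (a * x) - expR (a * y)).
Proof.
move=> a0; wlog yx : x y / y <= x.
  move=> H hx hy; have [/H|/ltW/H] := leP y x; first exact.
  by move/(_ hy hx); rewrite -[(y - x) * _]mulrNN !opprB -sqrrN opprB.
move=> /andP[x1 x2] /andP[y1 y2].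
have -> : expR (a * x) - expR (a * y) = expR (a * y) * (expR (a * (x - y)) - 1).
  by rewrite mulrBr mulr1 -expRD; congr (expR _ - _); ring.
have -> : a * expR (- a) * (x - y) ^+ 2 = (x - y) * (expR (- a) * (a * (x - y))) by ring.
apply: ler_wpM2l; first by rewrite subr_ge0.
apply: ler_pM; rewrite ?expR_ge0 ?mulr_ge0 ?subr_ge0 ?ler_expR//.
  by rewrite -[- a]mulrN1 ler_wpM2l.
by rewrite lerBrDl expR_ge1Dx.
Qed.

(** A finite-step form of the fact that the derivative of a tilted mean is a variance. One factor
    [expR (- a)] comes from the chord bound, the other from the normalizer, which is at most
    [expR a]. *)
Lemma variance_le_tilt (a : R) q : 0 <= a -> (forall s, -1 <= q s <= 1) ->
  a * expR (- (2 * a)) * (avg W (fun s => q s ^+ 2) - avg W q ^+ 2) <=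
  avg (fun s => W s * expR (a * q s)) q - avg W q.
Proof.
move=> a0 q1; set mu := avg W q.
have mu1 : -1 <= mu <= 1 by exact: avg_bounds.
pose E := avg W (fun s => expR (a * q s)).
have E_le : expR (- a) <= E <= expR a.
  apply: avg_bounds => s; have /andP[qs1 qs2] := q1 s; rewrite !ler_expR.
  by apply/andP; split; nra.
have E0 : 0 < E by have /andP[+ _] := E_le; apply: lt_le_trans; rewrite expR_gt0.
rewrite avg_tilt -/E.
(* Subtracting [expR (a * mu)] is free because [q - mu] has mean zero, and it turns the integrand
   into a chord. *)
have -> : avg W (fun s => q s * expR (a * q s)) / E - mu =
  avg W (fun s => (q s - mu) * (expR (a * q s) - expR (a * mu))) / E.
  rewrite [X in _ = avg W X / _](_ : _ = fun s =>
    q s * expR (a * q s) - (mu * expR (a * q s) + expR (a * mu) * (q s - mu))); last first.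
    by apply/funext => s; ring.
  rewrite avgB avgD !avgZ avgB avg_cst -/mu -/E subrr mulr0 addr0 mulrBl mulfK//.
  by rewrite gt_eqF.
rewrite [X in a * X * _](_ : _ = expR (- a) * expR (- a)); last first.
  by rewrite -expRD; congr expR; ring.
have -> : avg W (fun s => q s ^+ 2) - mu ^+ 2 = avg W (fun s => (q s - mu) ^+ 2).
  rewrite [X in _ = avg W X](_ : _ = fun s => q s ^+ 2 - (2 * mu * q s - mu ^+ 2)).
    by rewrite !avgB avgZ avg_cst -/mu; ring.
  by apply/funext => s; ring.
rewrite ler_pdivlMr//.
apply: (@le_trans _ _ (a * expR (- a) * avg W (fun s => (q s - mu) ^+ 2))); last first.
  by rewrite -avgZ; apply: le_avg => s; apply: expR_chord.
have V0 : 0 <= avg W (fun s => (q s - mu) ^+ 2).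
  by rewrite -(avg_cst 0); apply: le_avg => s; rewrite sqr_ge0.
have -> : a * (expR (- a) * expR (- a)) * avg W (fun s => (q s - mu) ^+ 2) * E =
  a * expR (- a) * avg W (fun s => (q s - mu) ^+ 2) * (expR (- a) * E) by ring.
rewrite ler_piMr ?(mulr_ge0 (mulr_ge0 a0 (expR_ge0 _)) V0)//.
rewrite expRN -ler_pdivlMl ?invr_gt0 ?expR_gt0// invrK mulr1.
by case/andP: E_le.
Qed.

End weighted_average.

Section replicas.
Context {R : realType} {S : finType}.
Variables (s0 : S) (W : S -> R) (k : nat).
Hypothesis W_gt0 : forall s, 0 < W s.

Definition replica_weight (x : {ffun 'I_k -> S}) : R := \prod_(a < k) W (x a).

Lemma replica_weight_gt0 x : 0 < replica_weight x.
Proof. exact: prodr_gt0. Qed.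

Lemma sum_replica_weight : \sum_x replica_weight x = (\sum_s W s) ^+ k.
Proof.
by rewrite /replica_weight -(bigA_distr_bigA (fun (_ : 'I_k) s => W s)) prodr_const card_ord.
Qed.

Lemma avg_replicas (f : S -> R) :
  avg replica_weight (fun x => \prod_(a < k) f (x a)) = avg W f ^+ k.
Proof.
rewrite /avg sum_replica_weight expr_div_n; congr (_ / _).
under eq_bigr do rewrite -big_split.
by rewrite -(bigA_distr_bigA (fun _ s => f s * W s)) prodr_const card_ord.
Qed.

End replicas.

(** * Griffiths inequalities *)

Section ising.
Context {R : realType} {n : nat}.
Notation config := {ffun 'I_n -> bool}.
Implicit Types (s xi : config) (t u : seq 'I_n).

(** Sequences rather than sets: a product of monomials is a concatenation, and repeated sites cancel
    in pairs because spins square to one. *)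
Definition monomial t s : R := \prod_(i <- t) spin R (s i).

Definition up : config := [ffun=> true].

Lemma spin_cases b : spin R b = 1 \/ spin R b = -1.
Proof. by case: b; [left|right]. Qed.

Lemma monomial_cases t s : monomial t s = 1 \/ monomial t s = -1.
Proof.
rewrite /monomial; elim: t => [|i t IH]; first by left; rewrite big_nil.
rewrite big_cons; case: IH => ->; case: (spin_cases (s i)) => ->;
  rewrite ?mulr1 ?mul1r ?mulrNN ?mulr1; by [left|right].
Qed.

Lemma monomial_bounds t s : -1 <= monomial t s <= 1.
Proof. by case: (monomial_cases t s) => ->; apply/andP; split; lra. Qed.

Lemma monomial_cat t u s : monomial (t ++ u) s = monomial t s * monomial u s.
Proof. exact: big_cat. Qed.

(** The sum factors over the sites, and the factor at [i] is 2 or 0 according to the parity of the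
    multiplicity of [i] in [t]. *)
Lemma sum_monomial_ge0 t : 0 <= \sum_s monomial t s.
Proof.
have -> : \sum_s monomial t s = \prod_i \sum_(b : bool) spin R b ^+ count_mem i t.
  rewrite bigA_distr_bigA; apply: eq_bigr => s _; rewrite /monomial.
  elim: t => [|i t IH]; first by rewrite big_nil big1.
  rewrite big_cons IH /=.
  under [RHS]eq_bigr do rewrite exprD.
  rewrite big_split/=; congr (_ * _).
  rewrite (bigD1 i)//= eqxx expr1 big1 ?mulr1// => j.
  by rewrite eq_sym => /negbTE ->.
apply: prodr_ge0 => i _; rewrite big_bool /spin expr1n.
rewrite -signr_odd; case: odd => /=; rewrite ?expr1 ?expr0; lra.
Qed.

(* [s * xi] for the group structure on configurations given by spins. *)
Definition flip xi s : config := [ffun i => s i == xi i].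

Lemma flipK xi : involutive (flip xi).
Proof. by move=> s; apply/ffunP => i; rewrite !ffunE; case: (s i); case: (xi i). Qed.

Lemma monomial_flip t xi s : monomial t (flip xi s) = monomial t s * monomial t xi.
Proof.
rewrite /monomial -big_split/=; apply: eq_bigr => i _; rewrite ffunE.
by case: (s i); case: (xi i); rewrite /spin ?mulrNN ?mulr1 ?mul1r.
Qed.

Section couplings.
Context {K : finType} (supp : K -> seq 'I_n).
Implicit Types c : K -> R.

(** An arbitrary finite index of interactions treats couplings and fields alike, so one monotonicity
    statement covers both. *)
Definition ising c s : R := expR (\sum_l c l * monomial (supp l) s).

Lemma ising_gt0 c s : 0 < ising c s.
Proof. exact: expR_gt0. Qed.

(** A monomial is a sign, so this is cosh [a] plus sinh [a] times the monomial. *)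
Lemma expR_monomial (a : R) t s : expR (a * monomial t s) =
  (expR a + expR (- a)) / 2 + (expR a - expR (- a)) / 2 * monomial t s.
Proof. by case: (monomial_cases t s) => ->; rewrite ?mulrN mulr1; field. Qed.

(** Expanding one interaction at a time gives coefficients cosh and sinh of [c l], nonnegative as
    [c l >= 0]; [t] is general in the induction because it absorbs the supports. *)
Lemma gks1_sum c t : (forall l, 0 <= c l) ->
  0 <= \sum_s monomial t s * ising c s.
Proof.
move=> c0; rewrite /ising; move: (index_enum K) => r.
elim: r t => [|l r IH] t.
  under eq_bigr do rewrite big_nil expR0 mulr1; exact: sum_monomial_ge0.
under eq_bigr => s _.
  rewrite big_cons expRD expR_monomial.
  rewrite [X in _ * (X * _)]addrC mulrDl mulrDr.
  rewrite [X in X + _](_ : _ = (expR (c l) - expR (- c l)) / 2 *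
    (monomial (t ++ supp l) s * expR (\sum_(j <- r) c j * monomial (supp j) s)));
    last by rewrite monomial_cat; ring.
  rewrite [X in _ + X](_ : _ = (expR (c l) + expR (- c l)) / 2 *
    (monomial t s * expR (\sum_(j <- r) c j * monomial (supp j) s)));
    last by ring.
  over.
rewrite big_split/= -!mulr_sumr addr_ge0// mulr_ge0// divr_ge0//.
by rewrite subr_ge0 ler_expR; have := c0 l; lra.
Qed.

Lemma gks1 c t : (forall l, 0 <= c l) -> 0 <= avg (ising c) (monomial t).
Proof.
move=> c0; rewrite divr_ge0 ?gks1_sum// sumr_ge0// => s _.
exact/ltW/ising_gt0.
Qed.

(* Ginibre's duplication: with [s' = s * xi], the two-replica weight is, for
   fixed [xi], again ferromagnetic in [s]. *)
Lemma gks2 c t u : (forall l, 0 <= c l) ->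
  avg (ising c) (monomial t) * avg (ising c) (monomial u) <=
  avg (ising c) (fun s => monomial t s * monomial u s).
Proof.
move=> c0.
have Z0 := sum_weight_gt0 up (ising c) (ising_gt0 c).
rewrite /avg mulrACA -invfM ler_pdivrMr ?mulr_gt0//.
rewrite mulrA mulfVK ?gt_eqF// -subr_ge0.
set Z := \sum_s ising c s; set A := \sum_s _ * _ * _.
have -> : A * Z - (\sum_s monomial t s * ising c s) * (\sum_s monomial u s * ising c s) =
  \sum_xi \sum_s (1 - monomial u xi) *
     (monomial (t ++ u) s * ising (fun l => c l * (1 + monomial (supp l) xi)) s).
  rewrite exchange_big/= /A !mulr_suml -sumrB; apply: eq_bigr => s _.
  rewrite /Z !mulr_sumr -sumrB (reindex_inj (inv_inj (flipK s)))/=.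
  apply: eq_bigr => xi _; rewrite monomial_flip monomial_cat.
  have -> : ising (fun l => c l * (1 + monomial (supp l) xi)) s =
            ising c s * ising c (flip s xi).
    rewrite /ising -expRD -big_split/=; congr expR; apply: eq_bigr => l _.
    by rewrite monomial_flip; ring.
  by ring.
apply: sumr_ge0 => xi _; rewrite -mulr_sumr mulr_ge0//.
  by rewrite subr_ge0; have /andP[] := monomial_bounds u xi.
apply: gks1_sum => l; rewrite mulr_ge0//.
by rewrite -lerBlDl sub0r; have /andP[] := monomial_bounds (supp l) xi.
Qed.

(** The exponential tilt is affine in [monomial (supp l)], so after clearing the normalizer the
    claim is [gks2] multiplied by sinh [a]. *)
Lemma avg_ising_incr1 c l (a : R) t : (forall l, 0 <= c l) -> 0 <= a ->
  avg (ising c) (monomial t) <=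
  avg (fun s => ising c s * expR (a * monomial (supp l) s)) (monomial t).
Proof.
move=> c0 a0; rewrite (avg_tilt up)//; last exact: ising_gt0.
set p := (expR a + expR (- a)) / 2; set q := (expR a - expR (- a)) / 2.
have q0 : 0 <= q by rewrite divr_ge0// subr_ge0 ler_expR; lra.
have p0 : 0 < p by rewrite divr_gt0// addr_gt0// expR_gt0.
have E0 : 0 < avg (ising c) (fun s => expR (a * monomial (supp l) s)).
  rewrite /avg divr_gt0//; last exact: (sum_weight_gt0 up _ (ising_gt0 c)).
  rewrite (bigD1 up)//= ltr_pwDl ?mulr_gt0 ?expR_gt0 ?ising_gt0//.
  by rewrite sumr_ge0// => s _; rewrite mulr_ge0 ?expR_ge0.
rewrite ler_pdivlMr//.
rewrite [X in _ * avg _ X](_ : _ = fun s => p * 1 + q * monomial (supp l) s); last first.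
  by apply/funext => s; rewrite expR_monomial mulr1.
rewrite [X in _ <= avg _ X](_ : _ = fun s =>
    p * monomial t s + q * (monomial t s * monomial (supp l) s)); last first.
  by apply/funext => s; rewrite expR_monomial -/p -/q; ring.
rewrite !avgD !avgZ (avg_cst up _ (ising_gt0 c)) mulrDr mulr1.
have H := gks2 c t (supp l) c0.
rewrite [X in X + _ <= _]mulrC lerD2l mulrCA.
exact: ler_wpM2l H.
Qed.

Lemma avg_ising_incr c c' t : (forall l, 0 <= c l) -> (forall l, c l <= c' l) ->
  avg (ising c) (monomial t) <= avg (ising c') (monomial t).
Proof.
move=> c0 cc'.
pose cr (r : seq K) l := if l \in r then c' l else c l.
have cr0 r l : 0 <= cr r l by rewrite /cr; case: ifP => // _; exact: le_trans (cc' l).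
suff H r : avg (ising c) (monomial t) <= avg (ising (cr r)) (monomial t).
  have -> : c' = cr (enum K) by apply/funext => l; rewrite /cr mem_enum.
  exact: H.
elim: r => [|l r IH].
  by have -> : cr [::] = c by apply/funext.
apply: (le_trans IH); have [lr|lr] := boolP (l \in r).
  suff -> : cr (l :: r) = cr r by [].
  apply/funext => j; rewrite /cr inE; case: (eqVneq j l) => // ->.
  by rewrite lr.
have -> : ising (cr (l :: r)) =
    (fun s => ising (cr r) s * expR ((c' l - c l) * monomial (supp l) s)).
  apply/funext => s; rewrite /ising -expRD; congr expR.
  rewrite (bigD1 l)//= [in RHS](bigD1 l)//= addrAC; congr (_ + _).
    by rewrite /cr inE eqxx (negbTE lr) -mulrDl; congr (_ * _); rewrite addrC subrK.
  by apply: eq_bigr => j jl; rewrite /cr inE (negbTE jl).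
apply: avg_ising_incr1 => //; by rewrite subr_ge0.
Qed.

End couplings.
End ising.

(** * Gibbs averages of the model *)

Section model.
Context {R : realType} {n : nat}.
Notation config := {ffun 'I_n -> bool}.
Notation K := ({set 'I_n} + 'I_n)%type.
Implicit Types (J : {set 'I_n} -> R) (tau : 'I_n -> R) (x : K -> R).

Definition supp (l : K) : seq 'I_n :=
  match l with inl X => enum X | inr i => [:: i] end.

(** Polymorphic in [A] so as to bundle both realized values and random variables; in the latter case
    it unfolds to the family in the independence hypothesis. *)
Definition disorder {A : Type} (J : {set 'I_n} -> A) (tau : 'I_n -> A) (l : K) : A :=
  match l with inl X => J X | inr i => tau i end.

Definition coupling (h0 h1 : R) x (l : K) : R :=
  match l with inl _ => x l | inr _ => h0 + h1 * x l end.

Lemma gweightE J tau h0 h1 :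
  gweight J tau h0 h1 = ising supp (coupling h0 h1 (disorder J tau)).
Proof.
apply/funext => s; rewrite /gweight /ising /hamiltonian big_sumType/=.
congr expR; rewrite !opprB opprK addrA addrC; congr (_ + _).
  by apply: eq_bigr => X _; rewrite /monomial big_enum.
rewrite !mulr_sumr -big_split/=; apply: eq_bigr => i _.
by rewrite /monomial big_seq1; ring.
Qed.

Lemma gweight_gt0 J tau h0 h1 s : 0 < gweight J tau h0 h1 s.
Proof. exact: expR_gt0. Qed.

Definition magnetization (s : config) : R := n%:R^-1 * \sum_(i < n) spin R (s i).

Definition site_mag J tau h0 h1 i : R :=
  avg (gweight J tau h0 h1) (fun s => spin R (s i)).

Definition pair_corr J tau h0 h1 i j : R :=
  avg (gweight J tau h0 h1) (fun s => spin R (s i) * spin R (s j)).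

Lemma monomial1 i : monomial [:: i] = (fun s => spin R (s i)) :> (config -> R).
Proof. by apply/funext => s; rewrite /monomial big_seq1. Qed.

Section averages.
Variables (J : {set 'I_n} -> R) (tau : 'I_n -> R) (h0 h1 : R).
Local Notation W := (gweight J tau h0 h1).
Let W_gt0 := gweight_gt0 J tau h0 h1.

Lemma avg_magnetization :
  avg W magnetization = n%:R^-1 * \sum_(i < n) site_mag J tau h0 h1 i.
Proof. by rewrite avgZ (avg_sum up _ W_gt0). Qed.

Lemma avg_magnetization_sq : avg W (fun s => magnetization s ^+ 2) =
  n%:R^-1 * n%:R^-1 * \sum_(i < n) \sum_(j < n) pair_corr J tau h0 h1 i j.
Proof.
rewrite [X in avg _ X](_ : _ = fun s : config => n%:R^-1 * n%:R^-1 *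
    \sum_(i < n) \sum_(j < n) spin R (s i) * spin R (s j)).
  rewrite avgZ (avg_sum up _ W_gt0); congr (_ * _); apply: eq_bigr => i _.
  by rewrite (avg_sum up _ W_gt0).
apply/funext => s; rewrite /magnetization expr2 mulrACA; congr (_ * _).
by rewrite mulr_suml; apply: eq_bigr => i _; rewrite mulr_sumr.
Qed.

Lemma gibbs_kE k F : gibbs_k k J tau h0 h1 F = avg (replica_weight W k) F.
Proof. by rewrite /gibbs_k /avg sum_replica_weight. Qed.

Let Wk_gt0 k := replica_weight_gt0 W k W_gt0.
Let upk k : {ffun 'I_k -> config} := [ffun=> up].

Lemma gibbs_Qk k : gibbs_k k J tau h0 h1 (@Qk R n k) =
  n%:R^-1 * \sum_(i < n) site_mag J tau h0 h1 i ^+ k.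
Proof.
rewrite gibbs_kE /Qk avgZ (avg_sum (upk k) _ (Wk_gt0 k)); congr (_ * _).
apply: eq_bigr => i _; exact: (avg_replicas W k (fun s => spin R (s i))).
Qed.

Lemma gibbs_Qk_deviation k (c : R) :
  gibbs_k k J tau h0 h1 (fun S => (Qk S - c) ^+ 2) =
  n%:R^-1 * n%:R^-1 * (\sum_(i < n) \sum_(j < n) pair_corr J tau h0 h1 i j ^+ k)
  - 2 * c * (n%:R^-1 * \sum_(i < n) site_mag J tau h0 h1 i ^+ k) + c ^+ 2.
Proof.
rewrite -gibbs_Qk !gibbs_kE.
rewrite [X in avg _ X](_ : _ = fun S : {ffun 'I_k -> config} => n%:R^-1 * n%:R^-1 *
    (\sum_(i < n) \sum_(j < n) \prod_(a < k) (spin R (S a i) * spin R (S a j)))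
    - 2 * c * Qk S + c ^+ 2).
  rewrite avgD avgB !avgZ (avg_cst (upk k) _ (Wk_gt0 k)) (avg_sum (upk k) _ (Wk_gt0 k)).
  congr (_ * _ - _ + _); apply: eq_bigr => i _.
  rewrite (avg_sum (upk k) _ (Wk_gt0 k)); apply: eq_bigr => j _.
  exact: (avg_replicas W k (fun s => spin R (s i) * spin R (s j))).
apply/funext => S.
have -> : \sum_(i < n) \sum_(j < n) \prod_(a < k) (spin R (S a i) * spin R (S a j)) =
  (\sum_(i < n) \prod_(a < k) spin R (S a i)) * (\sum_(i < n) \prod_(a < k) spin R (S a i)).
  rewrite mulr_suml; apply: eq_bigr => i _; rewrite mulr_sumr.
  by apply: eq_bigr => j _; rewrite -big_split.
by rewrite /Qk; ring.
Qed.

Lemma pair_corr_norm i j : `|pair_corr J tau h0 h1 i j| <= 1.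
Proof.
have H s : `|spin R (s i) * spin R (s j)| <= 1.
  rewrite normrM; case: (@spin_cases R (s i)) => ->; case: (@spin_cases R (s j)) => ->;
  by rewrite ?normrN normr1 mulr1.
exact (avg_norm_le up _ W_gt0 1 _ H).
Qed.

Hypotheses (J0 : forall X, 0 <= J X) (tau0 : forall i, 0 <= tau i).
Hypotheses (h00 : 0 <= h0) (h10 : 0 <= h1).

Let c0 l : 0 <= coupling h0 h1 (disorder J tau) l.
Proof. by case: l => [X|i] //=; rewrite addr_ge0// mulr_ge0. Qed.

Lemma site_mag_ge0 i : 0 <= site_mag J tau h0 h1 i.
Proof. by rewrite /site_mag gweightE -monomial1 gks1. Qed.

Lemma site_mag_pair_corr i j :
  site_mag J tau h0 h1 i * site_mag J tau h0 h1 j <= pair_corr J tau h0 h1 i j.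
Proof.
rewrite /site_mag /pair_corr gweightE -!monomial1.
have := @gks2 R n _ supp _ [:: i] [:: j] c0.
by rewrite [X in _ <= avg _ X](_ : _ = fun s : config => spin R (s i) * spin R (s j))// !monomial1.
Qed.

End averages.

(** * Increments in the uniform field [h0] *)

Section field_shift.
Variables (J : {set 'I_n} -> R) (tau : 'I_n -> R) (h1 : R).
Hypothesis n_gt0 : (0 < n)%N.

Let n0 : n%:R != 0 :> R. Proof. by rewrite pnatr_eq0 -lt0n. Qed.

Lemma gweight_shift h0 (dl : R) : gweight J tau (h0 + dl) h1 =
  fun s => gweight J tau h0 h1 s * expR (n%:R * dl * magnetization s).
Proof.
apply/funext => s; rewrite /gweight -expRD; congr expR.
rewrite /hamiltonian /magnetization.
set S := \sum_(i < n) spin R _.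
have -> : n%:R * dl * (n%:R^-1 * S) = dl * S by rewrite mulrACA mulfV// mul1r.
ring.
Qed.

Lemma magnetization_bounds s : -1 <= magnetization s <= 1.
Proof.
have nV : 0 < n%:R^-1 :> R by rewrite invr_gt0 ltr0n.
have b i : -1 <= spin R (s i) <= 1.
  by case: (@spin_cases R (s i)) => ->; apply/andP; split; lra.
rewrite /magnetization; apply/andP; split.
  rewrite -ler_pdivrMl// invrK mulrN1 -[n in n%:R]card_ord -sum1_card natr_sum -sumrN.
  by apply: ler_sum => i _; have /andP[] := b i.
rewrite -ler_pdivlMl// invrK mulr1 -[n in n%:R]card_ord -sum1_card natr_sum.
by apply: ler_sum => i _; have /andP[] := b i.
Qed.

(** Convexity as a tangent line below the graph, obtained from Jensen's inequality. The sign of [dl]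
    is free, and [pressure_increment_le] is the case [- dl] at the shifted field. *)
Lemma pressure_increment h0 (dl : R) :
  dl * avg (gweight J tau h0 h1) magnetization <=
  pressure J tau (h0 + dl) h1 - pressure J tau h0 h1.
Proof.
have nV : 0 < n%:R^-1 :> R by rewrite invr_gt0 ltr0n.
have := avg_le_ln_ratio up _ (gweight_gt0 J tau h0 h1) (fun s => n%:R * dl * magnetization s).
rewrite avgZ /pressure /partition -mulrBr -(ler_pM2l nV).
have <- : \sum_s gweight J tau (h0 + dl) h1 s =
    \sum_s gweight J tau h0 h1 s * expR (n%:R * dl * magnetization s).
  by apply: eq_bigr => s _; rewrite gweight_shift.
by rewrite !mulrA mulVf// mul1r.
Qed.

Lemma pressure_increment_le h0 (dl : R) :
  pressure J tau (h0 + dl) h1 - pressure J tau h0 h1 <=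
  dl * avg (gweight J tau (h0 + dl) h1) magnetization.
Proof.
have := pressure_increment (h0 + dl) (- dl).
by rewrite addrK mulNr lerNl opprB.
Qed.

Lemma magnetization_variance_le h0 (dl : R) : 0 < dl ->
  avg (gweight J tau h0 h1) (fun s => magnetization s ^+ 2) -
  avg (gweight J tau h0 h1) magnetization ^+ 2 <=
  expR (2 * (n%:R * dl)) / (n%:R * dl) *
  (avg (gweight J tau (h0 + dl) h1) magnetization -
   avg (gweight J tau h0 h1) magnetization).
Proof.
move=> dl0; rewrite gweight_shift.
have a0 : 0 < n%:R * dl by rewrite mulr_gt0// ltr0n.
rewrite -ler_pdivrMl ?divr_gt0 ?expR_gt0// invf_div -expRN.
apply: le_trans (variance_le_tilt up _ (gweight_gt0 J tau h0 h1) _ _ (ltW a0) magnetization_bounds).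
by [].
Qed.

(** The variance on the left of [magnetization_variance_le] is nonnegative, hence so is the
    increment on its right. *)
Lemma avg_magnetization_incr h0 (dl : R) : 0 <= dl ->
  avg (gweight J tau h0 h1) magnetization <=
  avg (gweight J tau (h0 + dl) h1) magnetization.
Proof.
rewrite le_eqVlt => /predU1P[<-|dl0]; first by rewrite addr0.
rewrite -subr_ge0.
have a0 : 0 < n%:R * dl by rewrite mulr_gt0// ltr0n.
have := magnetization_variance_le h0 dl dl0.
set A := avg _ _; set B := avg _ magnetization.
move=> H.
rewrite -(pmulr_rge0 _ (divr_gt0 (expR_gt0 (2 * (n%:R * dl))) a0)).
apply: le_trans H; rewrite /A /B.
have -> : avg (gweight J tau h0 h1) (fun s => magnetization s ^+ 2) -
   avg (gweight J tau h0 h1) magnetization ^+ 2 =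
   avg (gweight J tau h0 h1) (fun s => (magnetization s - B) ^+ 2).
  rewrite [RHS](_ : _ = avg (gweight J tau h0 h1)
    (fun s => magnetization s ^+ 2 - (2 * B * magnetization s - B ^+ 2))).
    by rewrite !avgB avgZ (avg_cst up _ (gweight_gt0 _ _ _ _)) -/B; ring.
  by congr avg; apply/funext => s; ring.
rewrite -(avg_cst up _ (gweight_gt0 J tau h0 h1) 0).
by apply: (le_avg up _ (gweight_gt0 J tau h0 h1)) => s; rewrite sqr_ge0.
Qed.

End field_shift.
End model.

(** * Thermal and disorder fluctuations *)

Lemma subr_expr_le {R : realType} (k : nat) (a b : R) : 0 <= b -> b <= a -> a <= 1 ->
  a ^+ k - b ^+ k <= k%:R * (a - b).
Proof.
move=> b0 ba a1; have a0 : 0 <= a := le_trans b0 ba.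
elim: k => [|k IH]; first by rewrite !expr0 subrr mul0r.
have -> : a ^+ k.+1 - b ^+ k.+1 = a * (a ^+ k - b ^+ k) + (a - b) * b ^+ k.
  by rewrite !exprS; ring.
rewrite [leRHS](_ : _ = k%:R * (a - b) + (a - b)); last by rewrite -natr1; ring.
rewrite lerD//.
  apply: le_trans IH; rewrite ler_piMl// subr_ge0.
  exact: lerXn2r.
by rewrite ler_piMr ?subr_ge0// exprn_ile1// (le_trans ba).
Qed.

(** Trades a deviation for its square, so that the variance of the pressure is the only moment to
    control; [s] is later chosen of the order of the standard deviation. *)
Lemma young {R : realType} (s z : R) : 0 < s -> z <= (2 * s)^-1 * z ^+ 2 + s / 2.
Proof.
move=> s0; rewrite -(ler_pM2l (mulr_gt0 (ltr0n R 2) s0)).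
have -> : 2 * s * ((2 * s)^-1 * z ^+ 2 + s / 2) = z ^+ 2 + s ^+ 2.
  by field; rewrite gt_eqF.
by rewrite -subr_ge0 [leRHS](_ : _ = (z - s) ^+ 2) ?sqr_ge0//; ring.
Qed.

(** The linear core of the convexity argument: [a], [m1], [m0] stand for magnetizations times the
    field step, and [y1], [y0] for the quadratic terms of [young] at the two ends of the step. *)
Lemma deviation_le {R : realType} (s a P1 P0 p1 p0 y1 y0 m1 m0 : R) :
  a <= P1 - P0 -> p1 - p0 <= m1 ->
  P1 - p1 <= y1 + s / 2 -> - (P0 - p0) <= y0 + s / 2 ->
  a - m0 <= y1 + y0 + s + (m1 - m0).
Proof. lra. Qed.

Lemma sqr_le_one_sided {R : realType} (G a m : R) :
  0 <= G -> a - m <= G -> 0 <= a <= 1 -> 0 <= m <= 1 ->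
  (a - m) ^+ 2 <= 2 * G - (a - m).
Proof.
move=> G0 BG /andP[a0 a1] /andP[m0 m1].
have [B0|/ltW B0] := leP 0 (a - m).
  have : (a - m) ^+ 2 <= a - m by rewrite expr2 ler_piMl//; lra.
  lra.
have : (a - m) ^+ 2 <= - (a - m) by rewrite -sqrrN expr2 ler_piMl ?oppr_ge0//; lra.
lra.
Qed.

(** * Measurability in the disorder *)

Section measurability_of_averages.
Context {R : realType} {d : measure_display} {T : measurableType d}.

Lemma measurable_avg (S : finType) (s0 : S) (W : T -> S -> R) (f : S -> R) :
  (forall w s, 0 < W w s) -> (forall s, measurable_fun setT (W^~ s)) ->
  measurable_fun setT (fun w => avg (W w) f).
Proof.
move=> W0 mW.
have mZ : measurable_fun setT (fun w => \sum_s W w s) by exact: measurable_sum.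
(* The normalizer is nonnegative, so its inverse is the real power of exponent -1, a measurable
   function. *)
rewrite [X in measurable_fun _ X](_ : _ = fun w =>
  (\sum_s f s * W w s) * (\sum_s W w s) `^ (-1)).
  apply: measurable_funM.
    by apply: measurable_sum => s; exact: measurable_funM.
  have H := measurableT_comp (@measurable_powR R (-1)) mZ; exact: H.
by apply/funext => w; rewrite powR_inv1// sumr_ge0// => s _; exact: ltW.
Qed.

Context {n : nat}.
Variables (J : {set 'I_n} -> T -> R) (tau : 'I_n -> T -> R) (h0 h1 : R).
Hypotheses (mJ : forall X, measurable_fun setT (J X))
  (mtau : forall i, measurable_fun setT (tau i)).
Let W w := gweight (J^~ w) (tau^~ w) h0 h1.

Lemma measurable_gweight s : measurable_fun setT (fun w => W w s).
Proof.
under eq_fun do rewrite /W gweightE.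
apply: measurableT_comp; first exact: measurable_expR.
apply: measurable_sum => -[X|i] /=.
  exact: measurable_funM.
apply: measurable_funM => //; apply: measurable_funD => //.
exact: measurable_funM.
Qed.

Lemma bm_avg_gweight (M : R) f : (forall s, `|f s| <= M) ->
  bounded_measurable (fun w => avg (W w) f).
Proof.
move=> fM; split.
  apply: (measurable_avg _ up) => [w s|s]; first exact: gweight_gt0.
  exact: measurable_gweight.
exists M => w; apply: (avg_norm_le up _ _ M _ fM); exact: gweight_gt0.
Qed.

Lemma bm_site_mag i :
  bounded_measurable (fun w => site_mag (J^~ w) (tau^~ w) h0 h1 i).
Proof.
have := @bm_avg_gweight 1 (fun s => spin R (s i)); apply => s.
by case: (@spin_cases R (s i)) => ->; rewrite ?normrN normr1.
Qed.

Lemma bm_pair_corr i j :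
  bounded_measurable (fun w => pair_corr (J^~ w) (tau^~ w) h0 h1 i j).
Proof.
have := @bm_avg_gweight 1 (fun s => spin R (s i) * spin R (s j)); apply => s.
rewrite normrM; case: (@spin_cases R (s i)) => ->; case: (@spin_cases R (s j)) => ->;
by rewrite ?normrN normr1 mulr1.
Qed.

Lemma bm_gibbs_Qk k :
  bounded_measurable (fun w => gibbs_k k (J^~ w) (tau^~ w) h0 h1 (@Qk R n k)).
Proof.
under eq_fun do rewrite gibbs_Qk; apply: bmM => //.
by apply: bm_sum => i; apply: bmX; exact: bm_site_mag.
Qed.

Lemma bm_gibbs_Qk_deviation k c : bounded_measurable
  (fun w => gibbs_k k (J^~ w) (tau^~ w) h0 h1 (fun S => (Qk S - c) ^+ 2)).
Proof.
under eq_fun do rewrite gibbs_Qk_deviation.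
apply: bmD => //; apply: bmB; apply: bmM => //.
  by apply: bm_sum => i; apply: bm_sum => j; apply: bmX; exact: bm_pair_corr.
by apply: bmM => //; apply: bm_sum => i; apply: bmX; exact: bm_site_mag.
Qed.

Lemma measurable_pressure :
  measurable_fun setT (fun w => pressure (J^~ w) (tau^~ w) h0 h1).
Proof.
apply: measurable_funM => //; apply: measurableT_comp; first exact: measurable_ln.
by apply: measurable_sum => s; exact: measurable_gweight.
Qed.

End measurability_of_averages.

(** * Variance bounds for everywhere nonnegative disorder *)

Section quenched.
Context {R : realType} {d : measure_display} {T : measurableType d}.
Variable P : probability T R.
Context {n : nat}.
Variables (J : {set 'I_n} -> T -> R) (tau : 'I_n -> T -> R) (h1 : R).
Hypotheses (n_gt0 : (0 < n)%N) (h1_ge0 : 0 <= h1).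
Hypotheses (mJ : forall X, measurable_fun setT (J X))
  (mtau : forall i, measurable_fun setT (tau i)).
Hypotheses (J_ge0 : forall X w, 0 <= J X w) (tau_ge0 : forall i w, 0 <= tau i w).
Hypothesis indep : mutually_independent P (disorder J tau).

Local Notation mag h i := (fun w => site_mag (J^~ w) (tau^~ w) h h1 i).
Local Notation corr h i j := (fun w => pair_corr (J^~ w) (tau^~ w) h h1 i j).
Local Notation av h f := (fun w => avg (gweight (J^~ w) (tau^~ w) h h1) f).
Local Notation prs h := (fun w => pressure (J^~ w) (tau^~ w) h h1).
Local Notation overlap k h c :=
  (fun w => gibbs_k k (J^~ w) (tau^~ w) h h1 (fun S => (Qk S - c) ^+ 2)).

Let bm_mag h i : bounded_measurable (mag h i).
Proof. exact: bm_site_mag. Qed.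
Let bm_corr h i j : bounded_measurable (corr h i j).
Proof. exact: bm_pair_corr. Qed.

Lemma site_mag_cov (phi psi : R -> R) h i j : 0 <= h ->
  measurable_fun setT phi -> measurable_fun setT psi ->
  (forall x y, 0 <= x -> x <= y -> y <= 1 -> phi x <= phi y) ->
  (forall x y, 0 <= x -> x <= y -> y <= 1 -> psi x <= psi y) ->
  Er P (fun w => phi (mag h i w)) * Er P (fun w => psi (mag h j w)) <=
  Er P (fun w => phi (mag h i w) * psi (mag h j w)).
Proof.
move=> h_ge0 mphi mpsi phi_incr psi_incr.
(* [harris] wants monotonicity at every real argument, while GKS needs nonnegative couplings.
   Truncating at 0 reconciles the two and changes nothing on the actual disorder. *)
pose c (x : {set 'I_n} + 'I_n -> R) := coupling h h1 (fun l => Num.max (x l) 0).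
have c_ge0 x l : 0 <= c x l.
  by case: l => [X|l] /=; rewrite ?addr_ge0 ?mulr_ge0// le_max lexx orbT.
pose mx i x := avg (ising supp (c x)) (@monomial R n [:: i]).
have mxE k w : mx k ((disorder J tau)^~ w) = mag h k w.
  rewrite /mx /site_mag gweightE -monomial1; congr (avg (ising _ _) _).
  by apply/funext => -[X|l] /=; rewrite max_l.
have mx01 k x : 0 <= mx k x <= 1.
  rewrite gks1//=; have /andP[_] := avg_bounds up _ (ising_gt0 supp (c x)) (-1) 1 _ (monomial_bounds [:: k]).
  exact.
have mx_incr k x y : (forall l, x l <= y l) -> mx k x <= mx k y.
  move=> xy; apply: avg_ising_incr => // -[X|l] /=.
    by rewrite ge_max !le_max xy lexx orbT.
  by rewrite lerD2l ler_wpM2l// ge_max !le_max xy lexx orbT.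
have mx_meas k : cyl_measurable (mx k).
  move=> d' T' Y mY; apply: (measurable_avg _ up) => [w s|s]; first exact: ising_gt0.
  apply: measurableT_comp; first exact: measurable_expR.
apply: measurable_sum => -[X|l].
    by apply: measurable_funM => //; apply: measurable_maxr.
  apply: measurable_funM => //; apply: measurable_funD => //.
  by apply: measurable_funM => //; apply: measurable_maxr.
have bnd (f : R -> R) : (forall x y, 0 <= x -> x <= y -> y <= 1 -> f x <= f y) ->
    forall k x, `|f (mx k x)| <= `|f 0| + `|f 1|.
  move=> f_incr k x; have /andP[m0 m1] := mx01 k x.
  rewrite ler_norml; apply/andP; split.
    apply: le_trans (f_incr 0 _ (lexx _) m0 m1).
    by have := ler_normr (f 0) (- f 0); have := normr_ge0 (f 1); have := ler_norm (- f 0); rewrite normrN; lra.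
  apply: le_trans (f_incr _ 1 m0 m1 (lexx _)) _.
  by have := normr_ge0 (f 0); have := ler_norm (f 1); lra.
have comp_meas (f : R -> R) k : measurable_fun setT f -> cyl_measurable (fun x => f (mx k x)).
  by move=> mf d' T' Y mY; exact: (measurableT_comp mf (mx_meas k _ _ _ mY)).
have md l : measurable_fun setT (disorder J tau l) by case: l.
have := harris P _ md indep (fun x => phi (mx i x)) (fun x => psi (mx j x)) _ _
  (comp_meas _ _ mphi) (comp_meas _ _ mpsi) (bnd _ phi_incr i) (bnd _ psi_incr j).
under [X in Er P X * _]eq_fun do rewrite mxE.
under [X in _ * Er P X]eq_fun do rewrite mxE.
under [X in _ <= Er P X]eq_fun do rewrite !mxE.
apply => x y xy.
  have /andP[m0 _] := mx01 i x; have /andP[_ m1] := mx01 i y.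
  by apply: phi_incr => //; exact: mx_incr.
have /andP[m0 _] := mx01 j x; have /andP[_ m1] := mx01 j y.
by apply: psi_incr => //; exact: mx_incr.
Qed.

(* Both [x ^+ k] and [k x - x ^+ k] increase on [0, 1], so each factor [x ^+ k]
   can be traded for [k x] at the price of a nonnegative covariance. *)
Lemma site_mag_cov_expr k h i j : 0 <= h ->
  Er P (fun w => mag h i w ^+ k * mag h j w ^+ k) -
  Er P (fun w => mag h i w ^+ k) * Er P (fun w => mag h j w ^+ k) <=
  k%:R ^+ 2 * (Er P (fun w => mag h i w * mag h j w) -
               Er P (mag h i) * Er P (mag h j)).
Proof.
move=> h_ge0.
have mX : measurable_fun setT (fun x : R => x ^+ k) by exact: measurable_funX.
have mL : measurable_fun setT (fun x : R => k%:R * x - x ^+ k).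
  by apply: measurable_funB => //; exact: measurable_funM.
have mid : measurable_fun setT (fun x : R => x) by exact: measurable_id.
have X_incr (x y : R) : 0 <= x -> x <= y -> y <= 1 -> x ^+ k <= y ^+ k.
  by move=> x0 xy _; apply: lerXn2r => //; rewrite nnegrE// (le_trans x0).
have L_incr (x y : R) : 0 <= x -> x <= y -> y <= 1 ->
    k%:R * x - x ^+ k <= k%:R * y - y ^+ k.
  by move=> x0 xy y1; have := subr_expr_le k y x x0 xy y1; lra.
have id_incr (x y : R) : 0 <= x -> x <= y -> y <= 1 -> x <= y by [].
have bX i' : bounded_measurable (fun w => mag h i' w ^+ k) by exact: bmX.
have bZ i' : bounded_measurable (fun w => k%:R * mag h i' w).
  by apply: bmM => //.
have I f : bounded_measurable f -> P.-integrable setT (EFin \o f) by exact: bm_integrable.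
(* The two applications meet at the covariance of [m_i] with [m_j ^ k]; each exchange costs a factor
   [k]. *)
have := site_mag_cov _ _ h i j h_ge0 mL mX L_incr X_incr.
under [X in _ <= Er P X]eq_fun do rewrite mulrBl -mulrA.
rewrite !ErB; try by apply: I; repeat (exact: bX || exact: bm_mag || apply: bmM => //).
rewrite !ErZ; try by apply: I; repeat (exact: bX || exact: bm_mag || apply: bmM => //).
have := site_mag_cov _ _ h i j h_ge0 mid mL id_incr L_incr.
under [X in _ <= Er P X]eq_fun do rewrite mulrBr mulrCA.
rewrite !ErB; try by apply: I; repeat (exact: bX || exact: bm_mag || apply: bmM => //).
rewrite !ErZ; try by apply: I; repeat (exact: bX || exact: bm_mag || apply: bmM => //).
rewrite expr2.
move=> /(ler_wpM2l (ler0n R k)); move: (Er P _) (Er P _) (Er P _) => a b c.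
move: (Er P _) (Er P _) (Er P _) => e f g; nra.
Qed.

Lemma overlap_deviation_le k h : 0 <= h ->
  Er P (overlap k h
    (Er P (fun w => gibbs_k k (J^~ w) (tau^~ w) h h1 (@Qk R n k)))) <=
  k%:R ^+ 2 * (Er P (av h (fun s => magnetization s ^+ 2)) -
               Er P (av h magnetization) ^+ 2).
Proof.
move=> h_ge0.
have I f : bounded_measurable f -> P.-integrable setT (EFin \o f) by exact: bm_integrable.
have bX i' p : bounded_measurable (fun w => mag h i' w ^+ p) by exact: bmX.
have bC i' j' p : bounded_measurable (fun w => corr h i' j' w ^+ p) by exact: bmX.
have bSX p : bounded_measurable (fun w => \sum_(i < n) mag h i w ^+ p).
  by apply: bm_sum => i; exact: bX.
have bSC p : bounded_measurable (fun w => \sum_(i < n) \sum_(j < n) corr h i j w ^+ p).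
  by apply: bm_sum => i; apply: bm_sum => j; exact: bC.
have meanE p : Er P (fun w => n%:R^-1 * \sum_(i < n) mag h i w ^+ p) =
    n%:R^-1 * \sum_(i < n) Er P (fun w => mag h i w ^+ p).
  by rewrite ErZ ?Er_sum//; exact: I.
have sqE p : Er P (fun w => n%:R^-1 * n%:R^-1 *
      \sum_(i < n) \sum_(j < n) corr h i j w ^+ p) =
    n%:R^-1 * n%:R^-1 * \sum_(i < n) \sum_(j < n) Er P (fun w => corr h i j w ^+ p).
  rewrite ErZ; last exact: I.
  rewrite Er_sum; last by move=> i; apply: bm_sum => j; exact: bC.
  by congr (_ * _); apply: eq_bigr => i _; rewrite Er_sum// => j; exact: bC.
(* The exponent stays general because both sides need it: [p = k] for the overlap and [p = 1] for
   the magnetization. *)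
have varE p : n%:R^-1 * n%:R^-1 *
      (\sum_(i < n) \sum_(j < n) Er P (fun w => corr h i j w ^+ p)) -
      (n%:R^-1 * \sum_(i < n) Er P (fun w => mag h i w ^+ p)) ^+ 2 =
    n%:R^-1 * n%:R^-1 * \sum_(i < n) \sum_(j < n)
      (Er P (fun w => corr h i j w ^+ p) -
       Er P (fun w => mag h i w ^+ p) * Er P (fun w => mag h j w ^+ p)).
  rewrite expr2 mulrACA -mulrBr; congr (_ * _).
  rewrite mulr_suml -sumrB; apply: eq_bigr => i _.
  by rewrite mulr_sumr -sumrB.
set c := Er P (fun w => gibbs_k _ _ _ _ _ (@Qk R n k)).
have cE : c = n%:R^-1 * \sum_(i < n) Er P (fun w => mag h i w ^+ k).
  by rewrite /c; under eq_fun do rewrite gibbs_Qk; exact: meanE.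
have -> : Er P (overlap k h c) = n%:R^-1 * n%:R^-1 *
      (\sum_(i < n) \sum_(j < n) Er P (fun w => corr h i j w ^+ k)) - c ^+ 2.
  under eq_fun do rewrite gibbs_Qk_deviation.
  rewrite ErD ?ErB ?sqE ?Er_cst; [|exact: I (bmM _ _ _ (bSC k))|
    by apply: I; apply: bmM => //; exact: bmM|
    by apply: I; apply: bmB; [exact: bmM|apply: bmM => //; exact: bmM]|exact: I].
  rewrite ErZ; last by apply: I; exact: bmM.
  by rewrite meanE -cE; ring.
rewrite cE varE.
have -> : Er P (av h (fun s => magnetization s ^+ 2)) - Er P (av h magnetization) ^+ 2 =
    n%:R^-1 * n%:R^-1 * \sum_(i < n) \sum_(j < n)
      (Er P (corr h i j) - Er P (mag h i) * Er P (mag h j)).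
  rewrite -(varE 1%N); congr (_ - _ ^+ 2).
    by under eq_fun do rewrite avg_magnetization_sq; exact: (sqE 1%N).
  by under eq_fun do rewrite avg_magnetization; exact: (meanE 1%N).
rewrite mulrCA ler_wpM2l ?mulr_ge0 ?invr_ge0//.
rewrite mulr_sumr ler_sum// => i _; rewrite mulr_sumr ler_sum// => j _.
have := site_mag_cov_expr k h i j h_ge0.
have gks w := site_mag_pair_corr (J^~ w) (tau^~ w) h h1 (J_ge0^~ w) (tau_ge0^~ w) h_ge0 h1_ge0 i j.
have m_ge0 i' w := site_mag_ge0 (J^~ w) (tau^~ w) h h1 (J_ge0^~ w) (tau_ge0^~ w) h_ge0 h1_ge0 i'.
have bmm : bounded_measurable (fun w => mag h i w * mag h j w) by exact: bmM.
have diff : Er P (fun w => corr h i j w ^+ k) -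
    Er P (fun w => mag h i w ^+ k * mag h j w ^+ k) <=
    k%:R * (Er P (corr h i j) - Er P (fun w => mag h i w * mag h j w)).
  rewrite -!ErB; [|by apply: I => //; exact: bmM..].
  rewrite -ErZ; last by apply: I; exact: bmB.
  apply: le_Er => [||w]; [by apply: I; apply: bmB => //; exact: bmM|
    by apply: I; apply: bmM => //; exact: bmB|].
  rewrite -exprMn; apply: subr_expr_le; [exact: mulr_ge0|exact: gks|].
  exact: le_trans (ler_norm _) (pair_corr_norm _ _ _ _ _ _).
have thermal_ge0 : Er P (fun w => mag h i w * mag h j w) <= Er P (corr h i j).
  by apply: le_Er => //; exact: I.
(* The thermal part costs only [k], the disorder part [k ^ 2]; this puts them under a common
   factor. *)
have kk : k%:R <= k%:R ^+ 2 :> R.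
  by rewrite -natrX ler_nat; clear; case: k => // m; rewrite expnS expn1 leq_pmulr.
have t0 : 0 <= Er P (corr h i j) - Er P (fun w => mag h i w * mag h j w) by rewrite subr_ge0.
have := ler_wpM2r t0 kk.
set c2 := Er P _ in diff *; set m2 := Er P _ in diff *.
set c1 := Er P _ in diff t0 *; set m1 := Er P _ in diff t0 *.
lra.
Qed.

Let M_av h : bounded_measurable (av h magnetization).
Proof.
apply: (bm_avg_gweight J tau h h1 mJ mtau 1) => s.
by rewrite ler_norml magnetization_bounds.
Qed.

Definition mean_mag h : R := Er P (av h magnetization).

Lemma avg_magnetization_01 h w : 0 <= h ->
  0 <= avg (gweight (J^~ w) (tau^~ w) h h1) magnetization <= 1.
Proof.
move=> h_ge0; apply/andP; split; last first.
  have /andP[_] := avg_bounds up _ (gweight_gt0 (J^~ w) (tau^~ w) h h1) (-1) 1 _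
    (magnetization_bounds n_gt0).
  exact.
rewrite avg_magnetization mulr_ge0 ?invr_ge0// sumr_ge0// => i _.
exact: site_mag_ge0.
Qed.

Lemma mean_mag_01 h : 0 <= h -> 0 <= mean_mag h <= 1.
Proof.
move=> h_ge0; have iA := bm_integrable P _ (M_av h).
apply/andP; split.
  rewrite -(Er_cst P 0); apply: le_Er => // [|w]; first exact: bm_integrable.
  by have /andP[] := avg_magnetization_01 h w h_ge0.
rewrite -(Er_cst P 1); apply: le_Er => // [|w]; first exact: bm_integrable.
by have /andP[] := avg_magnetization_01 h w h_ge0.
Qed.

Lemma mean_mag_incr h dl : 0 <= dl -> mean_mag h <= mean_mag (h + dl).
Proof.
move=> dl0; apply: le_Er => [||w]; try exact: bm_integrable.
exact: avg_magnetization_incr.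
Qed.

Lemma thermal_variance_le h dl : 0 < dl ->
  Er P (av h (fun s => magnetization s ^+ 2)) - Er P (fun w => av h magnetization w ^+ 2) <=
  expR (2 * (n%:R * dl)) / (n%:R * dl) * (mean_mag (h + dl) - mean_mag h).
Proof.
move=> dl0; have b2 : bounded_measurable (av h (fun s => magnetization s ^+ 2)).
  apply: (bm_avg_gweight _ _ _ _ mJ mtau 1) => s.
  by rewrite normrX exprn_ile1// ler_norml magnetization_bounds.
have bA2 : bounded_measurable (fun w => av h magnetization w ^+ 2) by exact: bmX.
rewrite -!ErB; try exact: bm_integrable.
rewrite -ErZ; last by apply: bm_integrable; exact: bmB.
apply: le_Er => [||w]; [by apply: bm_integrable; exact: bmB|
  by apply: bm_integrable; apply: bmM => //; exact: bmB|].
exact: magnetization_variance_le.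
Qed.

(** The function is dominated through [|f| <= (f - c) ^ 2 + |c| + 1]. The centre is arbitrary
    because [Er P f] is only the [fine] of an integral until integrability is known. *)
Lemma integrable_of_variance (f : T -> R) (c V : R) : measurable_fun setT f ->
  (Eb P (fun w => (f w - c) ^+ 2)%R <= V%:E)%E ->
  P.-integrable setT (EFin \o (fun w => (f w - c) ^+ 2)) /\
  P.-integrable setT (EFin \o f).
Proof.
move=> mf fV.
have mfc : measurable_fun setT (fun w => f w - c) by exact: measurable_funB.
have msq : measurable_fun setT (fun w => (f w - c) ^+ 2) by exact: measurable_funX.
have isq : P.-integrable setT (EFin \o (fun w => (f w - c) ^+ 2)).
  apply/integrableP; split; first exact/measurable_EFinP.
  under eq_integral do rewrite /= ger0_norm ?sqr_ge0//.
  by apply: le_lt_trans fV _; rewrite ltry.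
split => //.
have i1 : P.-integrable setT (EFin \o (fun=> `|c| + 1)) by exact: bm_integrable.
apply: (le_integrable measurableT _ _ (integrableD measurableT isq i1)).
- exact/measurable_EFinP.
- move=> w _; rewrite /= lee_fin [leRHS]ger0_norm; last first.
    by rewrite addr_ge0 ?sqr_ge0// addr_ge0.
  rewrite -{1}[f w](subrK c); apply: le_trans (ler_normD _ _) _.
  have -> : (f w - c) ^+ 2 = `|f w - c| ^+ 2 by rewrite real_normK// num_real.
  by have := normr_ge0 (f w - c); nra.
Qed.

(* Convexity of the pressure gives a one-sided bound on the deviation B of the
   magnetization; as B is centred and |B| <= 1, [B ^+ 2 <= |B| = 2 B^+ - B]
   turns it into a bound on the variance. *)
Lemma disorder_variance_le h dl s V : 0 <= h -> 0 < dl -> 0 < s ->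
  (forall h', h' = h \/ h' = h + dl ->
    (Eb P (fun w => (prs h' w - Er P (prs h')) ^+ 2)%R <= V%:E)%E) ->
  Er P (fun w => av h magnetization w ^+ 2) - mean_mag h ^+ 2 <=
  2 * ((V / s + s) / dl + (mean_mag (h + dl) - mean_mag h)).
Proof.
move=> h0 dl0 s0 conc.
have mp h' : measurable_fun setT (prs h') by exact: measurable_pressure.
have [isq0 ip0] := integrable_of_variance _ _ _ (mp h) (conc h (or_introl erefl)).
have [isq1 ip1] := integrable_of_variance _ _ _ (mp (h + dl)) (conc (h + dl) (or_intror erefl)).
have v0 := conc h (or_introl erefl); have v1 := conc (h + dl) (or_intror erefl).
rewrite (Er_Eb _ _ isq0) lee_fin in v0; rewrite (Er_Eb _ _ isq1) lee_fin in v1.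
set p0 := Er P (prs h) in isq0 v0; set p1 := Er P (prs (h + dl)) in isq1 v1.
pose A := av h magnetization.
have bA : bounded_measurable A by exact: M_av.
have iA : P.-integrable setT (EFin \o A) by exact: bm_integrable.
pose D := mean_mag (h + dl) - mean_mag h.
pose sq w := (prs (h + dl) w - p1) ^+ 2 + (prs h w - p0) ^+ 2.
(* [dl * G w] collects the bounds of [young] at [h] and [h + dl] and [dl] times the increment of the
   mean magnetization. *)
pose G w := (2 * s * dl)^-1 * sq w + (s / dl + D).
have p10 : p1 - p0 <= dl * mean_mag (h + dl).
  rewrite /p1 /p0 -ErB// -ErZ; last by apply: bm_integrable; exact: M_av.
  apply: le_Er => [||w].
  - exact: (integrableB measurableT ip1 ip0).
  - by apply: bm_integrable; apply: bmM => //; exact: M_av.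
  - exact: pressure_increment_le.
have D0 : 0 <= D by rewrite subr_ge0 mean_mag_incr// ltW.
have isq : P.-integrable setT (EFin \o sq) by exact: (integrableD measurableT isq1 isq0).
have isqZ : P.-integrable setT (EFin \o (fun w => (2 * s * dl)^-1 * sq w)).
  exact: (integrableZl measurableT _ isq).
have ic : P.-integrable setT (EFin \o (fun=> s / dl + D)) by exact: bm_integrable.
have iG : P.-integrable setT (EFin \o G) := integrableD measurableT isqZ ic.
have EG : Er P G = (2 * s * dl)^-1 * (Er P (fun w => (prs (h + dl) w - p1) ^+ 2) +
    Er P (fun w => (prs h w - p0) ^+ 2)) + (s / dl + D).
  rewrite -(ErD P _ _ isq1 isq0) -(ErZ P _ _ isq) -[X in _ = _ + X](Er_cst P).
  exact: (ErD P _ _ isqZ ic).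
have AG w : (A w - mean_mag h) ^+ 2 <= 2 * G w - (A w - mean_mag h).
  have G0 : 0 <= G w.
    apply: addr_ge0; last exact: addr_ge0 (divr_ge0 (ltW s0) (ltW dl0)) D0.
    apply: mulr_ge0; last exact: addr_ge0 (sqr_ge0 _) (sqr_ge0 _).
    by rewrite invr_ge0 !mulr_ge0// ltW.
  have BG : A w - mean_mag h <= G w.
    have H := @pressure_increment R n (J^~ w) (tau^~ w) h1 n_gt0 h dl.
    rewrite -(ler_pM2l dl0) mulrBr.
    have -> : dl * G w = (2 * s)^-1 * sq w + s + dl * D.
      by rewrite /G; field; rewrite !gt_eqF.
    have am1 := young s (prs (h + dl) w - p1) s0.
    have am0 := young s (- (prs h w - p0)) s0; rewrite sqrrN in am0.
    rewrite /sq [X in X + s]mulrDr [dl * D]mulrBr; exact: deviation_le H p10 am1 am0.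
  exact: sqr_le_one_sided G0 BG (avg_magnetization_01 h w h0) (mean_mag_01 h h0).
have iB2 : bounded_measurable (fun w => (A w - mean_mag h) ^+ 2).
  by apply: bmX; exact: bmB.
have iB : bounded_measurable (fun w => A w - mean_mag h) by exact: bmB.
have i2G : P.-integrable setT (EFin \o (fun w => 2 * G w)).
  exact: (integrableZl measurableT _ iG).
have -> : Er P (fun w => av h magnetization w ^+ 2) - mean_mag h ^+ 2 =
    Er P (fun w => (A w - mean_mag h) ^+ 2).
  rewrite [in RHS](_ : (fun w => _) = fun w => A w ^+ 2 - (2 * mean_mag h * A w - mean_mag h ^+ 2)).
    rewrite !ErB ?ErZ ?Er_cst//; try (apply: bm_integrable => //; repeat (exact: bmX || apply: bmB || apply: bmM) => //).
    by rewrite -/(mean_mag h); ring.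
  by apply/funext => w; ring.
have EB : Er P (fun w => A w - mean_mag h) = 0.
  by rewrite (ErB P A _ iA (bm_integrable P _ (bm_cst _))) Er_cst subrr.
have iBi := bm_integrable P _ iB.
have := le_Er P _ _ (bm_integrable P _ iB2) (integrableB measurableT i2G iBi) AG.
rewrite (ErB P _ _ i2G iBi) EB subr0 (ErZ P _ _ iG) EG.
move=> /le_trans; apply; rewrite ler_pM2l//.
have -> : (V / s + s) / dl = (2 * s * dl)^-1 * (V + V) + s / dl.
  by field; rewrite !gt_eqF.
rewrite -addrA lerD2r; apply: ler_wpM2l; last exact: lerD.
by rewrite invr_ge0 !mulr_ge0// ltW.
Qed.

(** The two field steps live on different scales: [n * dl2] must stay bounded to control the
    exponential, while [dl1] must dominate the fluctuations of the pressure. *)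
Lemma mean_overlap_deviation_le k h dl1 dl2 s V :
  0 <= h -> 0 < dl1 -> 0 < dl2 -> 0 < s ->
  (forall h', h' = h \/ h' = h + dl1 ->
    (Eb P (fun w => (prs h' w - Er P (prs h')) ^+ 2)%R <= V%:E)%E) ->
  Er P (overlap k h
    (Er P (fun w => gibbs_k k (J^~ w) (tau^~ w) h h1 (@Qk R n k)))) <=
  k%:R ^+ 2 *
  (expR (2 * (n%:R * dl2)) / (n%:R * dl2) * (mean_mag (h + dl2) - mean_mag h) +
   2 * ((V / s + s) / dl1 + (mean_mag (h + dl1) - mean_mag h))).
Proof.
move=> h_ge0 dl10 dl20 s0 conc; apply: le_trans (overlap_deviation_le k h h_ge0) _.
rewrite ler_wpM2l ?exprn_ge0//.
have th := thermal_variance_le h dl2 dl20.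
have dis := disorder_variance_le h dl1 s V h_ge0 dl10 s0 conc.
have := lerD th dis; rewrite addrA subrK; exact.
Qed.

End quenched.

(** * Iterated integrals without measurability *)

Section lower_integral.
Local Open Scope ereal_scope.
Context {d : measure_display} {T : measurableType d} {R : realType}.
Variable mu : {measure set T -> \bar R}.
Implicit Types (D : set T) (f g : T -> \bar R).

(** For a nonnegative integrand the integral is a supremum over simple functions below it, so
    monotonicity holds for arbitrary functions. *)
Lemma le_lower_integral D f g : (forall x, D x -> 0 <= f x) ->
  (forall x, D x -> f x <= g x) ->
  \int[mu]_(x in D) f x <= \int[mu]_(x in D) g x.
Proof.
move=> f0 fg; have g0 x : D x -> 0 <= g x by move=> Dx; exact: le_trans (f0 x Dx) (fg x Dx).
rewrite !ge0_integralE//; apply: ge_ereal_sup => _ [h hf <-].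
apply: ereal_sup_ubound; exists h => // x; apply: le_trans (hf x) _.
by rewrite !patchE; case: ifPn => // /set_mem/fg.
Qed.

Import HBNNSimple.

(** A sum of simple minorants is a simple minorant of the sum; finiteness of the right side allows
    the two suprema to be taken in turn. *)
Lemma lower_integral_superadditive D f g :
  (forall x, D x -> 0 <= f x) -> (forall x, D x -> 0 <= g x) ->
  \int[mu]_(x in D) f x + \int[mu]_(x in D) g x <= \int[mu]_(x in D) (f x + g x).
Proof.
move=> f0 g0; set c := leRHS.
have fg0 x : D x -> 0 <= f x + g x by move=> Dx; rewrite adde_ge0 ?f0 ?g0.
have c0 : 0 <= c by exact: integral_ge0.
have [->|cfin] := eqVneq c +oo; first by rewrite leey.
have {}cfin : c \is a fin_num by rewrite ge0_fin_numE// lt_neqAle cfin leey.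
have fc : \int[mu]_(x in D) f x <= c.
  by apply: le_lower_integral => // x Dx; rewrite leeDl ?g0.
have gc : \int[mu]_(x in D) g x <= c.
  by apply: le_lower_integral => // x Dx; rewrite leeDr ?f0.
have fin_le x : 0 <= x -> x <= c -> x \is a fin_num.
  by move=> x0 xc; rewrite ge0_fin_numE// (le_lt_trans xc)// -ge0_fin_numE.
have gfin : \int[mu]_(x in D) g x \is a fin_num by apply: fin_le => //; exact: integral_ge0.
rewrite -leeBrDr//; rewrite {1}ge0_integralE//.
apply: ge_ereal_sup => _ [h1 h1f <-].
have h1fin : sintegral mu h1 \is a fin_num.
  apply: fin_le; first exact: sintegral_ge0.
  apply: le_trans fc; rewrite ge0_integralE//.
  by apply: ereal_sup_ubound; exists h1.
rewrite leeBrDr// addeC -leeBrDr//; rewrite ge0_integralE//.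
apply: ge_ereal_sup => _ [h2 h2g <-].
rewrite leeBrDr// -sintegralD /c ge0_integralE//.
apply: ereal_sup_ubound; exists (add_nnsfun h2 h1) => // x /=.
rewrite EFinD; have := leeD (h2g x) (h1f x); move/le_trans; apply.
by rewrite !patchE; case: ifPn => _; rewrite ?adde0// addeC.
Qed.

Lemma lower_integral_sum (D : set T) (F : nat -> T -> \bar R) N :
  (forall j x, D x -> 0 <= F j x) ->
  \sum_(j < N) \int[mu]_(x in D) F j x <= \int[mu]_(x in D) (\sum_(j < N) F j x).
Proof.
move=> F0; elim: N => [|N IH].
  by rewrite big_ord0 integral_ge0// => x _; rewrite big_ord0.
rewrite big_ord_recr/=.
apply: (le_trans (leeD2r _ IH)).
apply: (le_trans (lower_integral_superadditive D _ _ _ (F0 N))).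
  by move=> x Dx; apply: sume_ge0 => j _; exact: F0.
apply: le_lower_integral => x Dx.
  by rewrite adde_ge0 ?F0//; apply: sume_ge0 => j _; exact: F0.
by rewrite big_ord_recr.
Qed.

End lower_integral.

(* Only the outer variable is cut into cells: the inner integrand is not known
   to be measurable, and superadditivity of the (lower) integral in [x] is what
   lets the bounds over the cells be summed before integrating. *)
Lemma iterated_integral_le {R : realType} (f : R -> R -> \bar R) (F : nat -> R -> R)
  (hl hu al au dl B : R) (N : nat) :
  al <= au -> 0 < dl -> hu < hl + N%:R * dl -> 0 <= B ->
  (forall h x, (0 <= f h x)%E) ->
  (forall j x, 0 <= F j x) ->
  (forall x, \sum_(j < N) F j x <= B) ->
  (forall (h x : R) j, hl + j%:R * dl <= h -> h < hl + j.+1%:R * dl -> h <= hu ->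
    al <= x <= au -> (f h x <= (F j x)%:E)%E) ->
  (\int[lebesgue_measure]_(h in `[hl, hu])
    \int[lebesgue_measure]_(x in `[al, au]) f h x <= (dl * B * (au - al))%:E)%E.
Proof.
move=> alu dl0 huN B0 f0 F0 FB fF.
pose cell (j : nat) : set R := `[hl + j%:R * dl, hl + j.+1%:R * dl[%classic.
pose I j := (\int[lebesgue_measure]_(x in `[al, au]) (F j x)%:E)%E.
have I0 j : (0 <= I j)%E by apply: integral_ge0 => x _; rewrite lee_fin.
have mcell j : measurable (cell j) by exact: measurable_itv.
have sumI : (\sum_(j < N) I j <= (B * (au - al))%:E)%E.
  have := lower_integral_sum (@lebesgue_measure R) `[al, au]%classic
    (fun j x => (F j x)%:E) N (fun j x _ => F0 j x).
  move=> /le_trans; apply.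
  apply: (@le_trans _ _ (\int[lebesgue_measure]_(x in `[al, au]) (cst B%:E x))%E).
    apply: le_lower_integral => x _; first by apply: sume_ge0 => j _; rewrite lee_fin.
    by rewrite sumEFin lee_fin.
  rewrite integral_cst//= lebesgue_measure_itv/= lte_fin; case: ifPn => // _.
  by rewrite mule0 lee_fin mulr_ge0// subr_ge0.
(* The majorant is a step function of [h], hence measurable, so its integral splits exactly over the
   cells. *)
apply: (@le_trans _ _ (\int[lebesgue_measure]_(h in `[hl, hu])
    \sum_(j < N) (I j * (\1_(cell j) h)%:E))%E).
  apply: le_lower_integral => h; rewrite /= in_itv/= => /andP[hlh hhu].
    exact: integral_ge0.
  pose j := Num.truncn ((h - hl) / dl).
  have q0 : 0 <= (h - hl) / dl by rewrite divr_ge0 ?subr_ge0// ltW.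
  have /andP[j1 j2] := truncn_itv q0.
  have hj1 : hl + j%:R * dl <= h by rewrite -lerBrDl -ler_pdivlMr.
  have hj2 : h < hl + j.+1%:R * dl by rewrite -ltrBlDl -ltr_pdivrMr.
  have jN : (j < N)%N.
    rewrite -(ltr_nat R) -(ltr_pM2r dl0).
    by move: (le_lt_trans hhu huN) hj1; lra.
  rewrite (bigD1 (Ordinal jN))//= indicE mem_set; last by rewrite /cell /= in_itv/= hj1.
  rewrite mule1; apply: (@le_trans _ _ (I j)).
    apply: le_lower_integral => x //; rewrite /= in_itv/= => xab.
    exact: fF hj1 hj2 hhu xab.
  rewrite leeDl//; apply: sume_ge0 => i _.
  by apply: mule_ge0; rewrite ?I0// lee_fin indicE ler0n.
rewrite ge0_integral_sum//; last 2 first.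
- by move=> j; apply: measurable_funeM; apply/measurable_EFinP/measurable_funTS/measurable_indicP; exact: mcell.
- by move=> j h _; apply: mule_ge0; rewrite ?I0// lee_fin indicE ler0n.
apply: (@le_trans _ _ (\sum_(j < N) I j * dl%:E)%E).
  apply: lee_sum => j _; rewrite ge0_integralZl//; last first.
  by apply/measurable_EFinP/measurable_funTS/measurable_indicP; exact: mcell.
  rewrite lee_wpmul2l// integral_indic//; last exact: mcell.
  apply: (@le_trans _ _ (lebesgue_measure (cell j))).
    apply: le_measure; rewrite ?inE; [|exact: mcell|exact: subIsetl].
    by apply: measurableI => //; exact: mcell.
  rewrite /cell lebesgue_measure_itv/= lte_fin; case: ifPn => _.
    by rewrite -EFinB lee_fin -natr1; lra.
  by rewrite lee_fin ltW.
apply: (@le_trans _ _ ((\sum_(j < N) I j) * dl%:E)%E); first by rewrite ge0_sume_distrl.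
rewrite [leRHS](_ : _ = (B * (au - al))%:E * dl%:E)%E; last by rewrite -EFinM; congr EFin; ring.
by rewrite lee_wpmul2r// lee_fin ltW.
Qed.

(** * The Poisson fields *)

(** The point masses at the naturals add up to 1, so [X] is almost surely a natural number. *)
Lemma poisson_ae_ge0 {R : realType} {d : measure_display} {T : measurableType d}
  (P : probability T R) (X : T -> R) (rate : R) : measurable_fun setT X ->
  0 < rate -> (forall m : nat, P [set w | X w = m%:R] = (poisson_pmf rate m)%:E) ->
  \forall w \ae P, 0 <= X w.
Proof.
move=> mX rate0 lawX.
pose A (m : nat) := [set w | X w = m%:R].
have mA m : measurable (A m).
  have := mX measurableT _ (measurable_set1 (m%:R : R)); rewrite setTI.
  by congr measurable.
have tA : trivIset setT A.
  apply/trivIsetP => i j _ _ /eqP ij; apply/seteqP; split => w //= [].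
  by rewrite /A /= => -> /eqP; rewrite eqr_nat => /eqP.
have PA : P (\bigcup_m A m) = 1%E.
  have := @measure_semi_bigcup _ _ _ P A mA tA (bigcup_measurable (fun k _ => mA k)).
  move=> ->.
  have := probability_setT (poisson_prob rate 0 : probability _ R).
  rewrite /= /poisson_prob rate0 -nneseries_esumT; last first.
    by move=> *; rewrite lee_fin poisson_pmf_ge0.
  move=> <-; apply: eq_eseriesr => m _; exact: lawX.
exists (~` \bigcup_m A m); split.
- by apply: measurableC; exact: bigcup_measurable.
- by rewrite probability_setC ?PA ?subee//; exact: bigcup_measurable.
- apply: subsetC => w [m _ Am] /=; rewrite Am; exact: ler0n.
Qed.

Section positive_part.
Context {R : realType} {d : measure_display} {T : measurableType d}.
Variable P : probability T R.
Context {n : nat}.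
Variables (J : {set 'I_n} -> T -> R) (tau : 'I_n -> T -> R) (h1 rate : R).
Hypotheses (n_gt0 : (0 < n)%N) (h1_ge0 : 0 <= h1) (rate_gt0 : 0 < rate).
Hypotheses (mJ : forall X, measurable_fun setT (J X))
  (mtau : forall i, measurable_fun setT (tau i)).
Hypothesis J_ge0 : forall X w, 0 <= J X w.
Hypothesis tau_law : forall i (m : nat),
  P [set w | tau i w = m%:R] = (poisson_pmf rate m)%:E.
Hypothesis indep : mutually_independent P (disorder J tau).

(** Almost surely equal to [tau], but nonnegative everywhere as the variance bounds require;
    truncating each coordinate separately preserves independence. *)
Definition pos_part (i : 'I_n) (w : T) : R := Num.max (tau i w) 0.

Lemma pos_part_ge0 i w : 0 <= pos_part i w.
Proof. by rewrite /pos_part le_max lexx orbT. Qed.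

Lemma measurable_pos_part i : measurable_fun setT (pos_part i).
Proof. exact: measurable_maxr. Qed.

Lemma pos_part_indep : mutually_independent P (disorder J pos_part).
Proof.
move=> B mB.
pose B' (l : {set 'I_n} + 'I_n) : set R :=
  match l with inl X => B (inl X) | inr i => [set x | B (inr i) (Num.max x 0)] end.
have mB' l : measurable (B' l).
  case: l => [X|i]; first exact: mB.
  have mmax : measurable_fun setT (fun x : R => Num.max x 0) by exact: measurable_maxr.
  by rewrite -[X in measurable X]setTI; exact: mmax.
have preE l : disorder J pos_part l @^-1` B l = disorder J tau l @^-1` B' l by case: l.
under eq_bigcapr do rewrite preE.
by rewrite (indep _ mB'); apply: eq_bigr => l _; rewrite preE.
Qed.

Let tauE : \forall w \ae P, tau^~ w = pos_part^~ w.
Proof.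
have H : \forall w \ae P, forall i, 0 <= tau i w.
  by apply: filter_forall => i; exact: poisson_ae_ge0 (mtau i) rate_gt0 (tau_law i).
by apply: filterS H => w w0; apply/funext => i; rewrite /pos_part max_l.
Qed.

Lemma overlap_deviation_bound k h dl1 dl2 s V :
  0 <= h -> 0 < dl1 -> 0 < dl2 -> 0 < s ->
  (forall h', h' = h \/ h' = h + dl1 ->
    (Eb P (fun w => (pressure (J^~ w) (tau^~ w) h' h1 -
      Er P (fun w' => pressure (J^~ w') (tau^~ w') h' h1)) ^+ 2)%R <= V%:E)%E) ->
  (Eb P (fun w => gibbs_k k (J^~ w) (tau^~ w) h h1 (fun S => (Qk S -
      Er P (fun w' => gibbs_k k (J^~ w') (tau^~ w') h h1 (@Qk R n k))) ^+ 2)%R) <=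
  (k%:R ^+ 2 *
  (expR (2 * (n%:R * dl2)) / (n%:R * dl2) *
     (mean_mag P J pos_part h1 (h + dl2) - mean_mag P J pos_part h1 h) +
   2 * ((V / s + s) / dl1 +
     (mean_mag P J pos_part h1 (h + dl1) - mean_mag P J pos_part h1 h))))%:E)%E.
Proof.
move=> h0 dl10 dl20 s0 conc.
have mp := measurable_pos_part.
have -> : Er P (fun w => gibbs_k k (J^~ w) (tau^~ w) h h1 (@Qk R n k)) =
    Er P (fun w => gibbs_k k (J^~ w) (pos_part^~ w) h h1 (@Qk R n k)).
  apply: ae_eq_Er; [exact: (bm_gibbs_Qk _ _ _ _ mJ mtau _).1|
    exact: (bm_gibbs_Qk _ _ _ _ mJ mp _).1|].
  by apply: filterS tauE => w ->.
set c := Er P _.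
have -> : Eb P (fun w => gibbs_k k (J^~ w) (tau^~ w) h h1 (fun S => (Qk S - c) ^+ 2)%R) =
    Eb P (fun w => gibbs_k k (J^~ w) (pos_part^~ w) h h1 (fun S => (Qk S - c) ^+ 2)%R).
  apply: ae_eq_Eb; [exact: (bm_gibbs_Qk_deviation _ _ _ _ mJ mtau _ _).1|
    exact: (bm_gibbs_Qk_deviation _ _ _ _ mJ mp _ _).1|].
  by apply: filterS tauE => w ->.
rewrite Er_Eb; last exact: bm_integrable (bm_gibbs_Qk_deviation _ _ _ _ mJ mp _ _).
rewrite lee_fin.
apply: (mean_overlap_deviation_le P J pos_part h1 n_gt0 h1_ge0 mJ mp J_ge0
  pos_part_ge0 pos_part_indep k h dl1 dl2 s V h0 dl10 dl20 s0).
move=> h' hh'; apply: le_trans (conc h' hh').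
have mpr (t : 'I_n -> T -> R) : (forall i, measurable_fun setT (t i)) ->
    measurable_fun setT (fun w => pressure (J^~ w) (t^~ w) h' h1).
  by move=> mt; exact: measurable_pressure.
have -> : Er P (fun w => pressure (J^~ w) (pos_part^~ w) h' h1) =
    Er P (fun w => pressure (J^~ w) (tau^~ w) h' h1).
  apply: ae_eq_Er; [exact: mpr|exact: mpr|].
  by apply: filterS tauE => w ->.
rewrite le_eqVlt; apply/orP; left; apply/eqP; apply: ae_eq_Eb.
- by apply: measurable_funX; apply: measurable_funB => //; exact: mpr.
- by apply: measurable_funX; apply: measurable_funB => //; exact: mpr.
- by apply: filterS tauE => w ->.
Qed.

End positive_part.

(** * Conclusion *)

(** An increment of length [L] is a sum of [L] unit increments at shifted positions; each of the
    resulting [L] sums telescopes to at most 1. *)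
Lemma sum_increments_le {R : realType} (m : nat -> R) (N L : nat) :
  (forall j, 0 <= m j <= 1) -> \sum_(j < N) (m (j + L)%N - m j) <= L%:R.
Proof.
move=> m01; elim: L => [|L IH].
  by rewrite big1// => j _; rewrite addn0 subrr.
rewrite [leLHS](_ : _ = \sum_(0 <= j < N) (m (j.+1 + L)%N - m (j + L)%N) +
    \sum_(j < N) (m (j + L)%N - m j)); last first.
  rewrite big_mkord -big_split/=; apply: eq_bigr => j _.
  by rewrite addnS addSn; ring.
rewrite -natr1 addrC lerD// (telescope_sumr (fun j => m (j + L)%N))//.
have /andP[_ a1] := m01 (N + L)%N; have /andP[b0 _] := m01 (0 + L)%N.
by lra.
Qed.

Lemma tanhR_gt0 {R : realType} (x : R) : 0 < x -> 0 < tanhR x.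
Proof.
move=> x0; apply: divr_gt0; last by rewrite addr_gt0 ?expR_gt0.
by rewrite subr_gt0 ltr_expR; lra.
Qed.

(** With [y = n ^ (1/8)] and [e = y ^ (-2)], each of the three contributions is at most a constant
    times [e]. One factor [1 / y] absorbs the constants into [c1], the other is at most [1 / g]. *)
Lemma final_scale {R : realType} (y nR dl2 N CP k2 w c1 g : R) :
  1 <= y -> nR = y ^+ 8 -> dl2 = (y ^+ 2)^-1 / nR ^+ 2 -> 0 <= N -> N * dl2 <= 2 -> 0 < CP ->
  0 <= k2 -> 0 <= w -> w <= 1 -> 0 < g -> g <= y ->
  2 * expR 2 + 4 * CP + 8 <= c1 * y ->
  dl2 * (k2 * (expR (2 * (nR * dl2)) / (nR * dl2) * 2 +
    N * (2 * ((CP / nR / (y ^+ 2)^-1 ^+ 2 + (y ^+ 2)^-1 ^+ 2) / (y ^+ 2)^-1)) +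
    2 * (nR ^+ 2 + 1))) * w <= k2 * c1 / g.
Proof.
move=> y1 nE dlE N0 Ndl CP0 k20 w0 w1 g0 gy cy.
have y0 : 0 < y by exact: lt_le_trans y1.
have y0' : y != 0 by rewrite gt_eqF.
set e := (y ^+ 2)^-1 in dlE *.
have e0 : 0 < e by rewrite invr_gt0 exprn_gt0.
have e1 : e <= 1 by rewrite invf_le1 ?exprn_gt0// exprn_ege1.
have n0 : 0 < nR by rewrite nE exprn_gt0.
have n1 : 1 <= nR by rewrite nE exprn_ege1.
have nV : nR^-1 = e ^+ 4 by rewrite nE /e exprVn -exprM.
have ee : e ^+ 4 <= e.
  by rewrite exprS; apply: ler_piMr; [exact: ltW|apply: exprn_ile1 => //; exact: ltW].
have dl0 : 0 < dl2 by rewrite dlE divr_gt0// exprn_gt0.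
have ndl1 : nR * dl2 <= 1.
  rewrite dlE [leLHS](_ : _ = e / nR); last by field; rewrite gt_eqF.
  by rewrite ler_pdivrMr// mul1r (le_trans e1).
have t1 : dl2 * (expR (2 * (nR * dl2)) / (nR * dl2) * 2) <= 2 * expR 2 * e.
  rewrite [leLHS](_ : _ = 2 * (expR (2 * (nR * dl2)) * e ^+ 4)); last first.
    by rewrite -nV; field; rewrite !gt_eqF.
  rewrite -mulrA ler_pM2l//; apply: ler_pM; [exact: expR_ge0|exact/exprn_ge0/ltW| |by []].
  by rewrite ler_expR; move: ndl1; lra.
have t2 : dl2 * (N * (2 * ((CP / nR / e ^+ 2 + e ^+ 2) / e))) <= 4 * (CP + 1) * e.
  rewrite [leLHS](_ : _ = (N * dl2) * (2 * (CP + 1) * e)); last first.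
    by rewrite nV; field; rewrite gt_eqF.
  rewrite [leRHS](_ : _ = 2 * (2 * (CP + 1) * e)); last by ring.
  by rewrite ler_wpM2r// !mulr_ge0 ?addr_ge0// ltW.
have t3 : dl2 * (2 * (nR ^+ 2 + 1)) <= 4 * e.
  rewrite [leLHS](_ : _ = 2 * (e + dl2)); last by rewrite dlE; field; rewrite gt_eqF.
  have : dl2 <= e.
    rewrite dlE ler_pdivrMr ?exprn_gt0//; apply: ler_peMr; first exact: ltW.
    exact: exprn_ege1.
  by lra.
set B := (X in dl2 * (k2 * X) * w).
have tot : dl2 * B <= (2 * expR 2 + 4 * CP + 8) * e.
  by rewrite /B !mulrDr; move: t1 t2 t3; rewrite !mulrDr; lra.
have B0 : 0 <= dl2 * B.
  rewrite mulr_ge0 ?(ltW dl0)// /B !addr_ge0// ?mulr_ge0 ?expR_ge0 ?invr_ge0 ?addr_ge0 ?mulr_ge0 ?exprn_ge0 ?invr_ge0 ?exprn_ge0//; by apply: ltW.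
apply: (@le_trans _ _ (k2 * (dl2 * B))).
  rewrite [leLHS](_ : _ = (k2 * (dl2 * B)) * w); last by ring.
  by rewrite ler_piMr// mulr_ge0.
rewrite -mulrA ler_wpM2l//; apply: le_trans tot _.
apply: (@le_trans _ _ (c1 * y * e)); first by rewrite ler_wpM2r// ltW.
rewrite ler_pdivlMr// [leLHS](_ : _ = c1 * (g / y)); last first.
  by rewrite /e; field.
have c10 : 0 <= c1.
  rewrite -(pmulr_lge0 _ y0); apply: le_trans cy.
  by rewrite !addr_ge0 ?mulr_ge0 ?expR_ge0// ltW.
by rewrite ler_piMr// ler_pdivrMr// mul1r.
Qed.

Theorem theorem2p3 (R : realType) (d : measure_display) (T : measurableType d)
  (P : probability T R)
  (theta hl hu al au h1 : R) (k : nat)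
  (J : forall n : nat, {set 'I_n} -> T -> R)
  (tau : forall n : nat, R -> 'I_n -> T -> R)
  (C CP : R) :
  1 / 2 < theta <= 7 / 8 ->
  0 < hl -> hl <= hu -> hu < 1 ->
  0 < al -> al <= au -> au < 1 ->
  0 < h1 <= 1 ->
  (1 <= k)%N ->
  (forall n X, measurable_fun setT (J n X)) ->
  (forall n X w, 0 <= J n X w) ->
  (forall n X, P.-integrable setT (fun w => ((J n X w) ^+ 2)%:E)) ->
  (forall n, \sum_(X : {set 'I_n}) Var P (J n X) <= C * n%:R) ->
  (forall n alpha i, measurable_fun setT (tau n alpha i)) ->
  (forall n alpha i (m : nat), (0 < n)%N -> 0 < alpha < 1 ->
     P [set w | tau n alpha i w = m%:R] =
       (poisson_pmf (alpha * n%:R `^ (theta - 1)) m)%:E) ->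
  (forall n alpha, (0 < n)%N -> 0 < alpha < 1 ->
     mutually_independent P
       (fun x : {set 'I_n} + 'I_n =>
          match x with inl X => J n X | inr i => tau n alpha i end)) ->
  0 < CP ->
  (forall n (h0 alpha : R), (0 < n)%N -> 0 < h0 < 1 -> 0 < alpha < 1 ->
     (Eb P (fun w =>
       (pressure (fun X => J n X w) (fun i => tau n alpha i w) h0 h1
        - Er P (fun w' => pressure (fun X => J n X w') (fun i => tau n alpha i w') h0 h1))
       ^+ 2)%R
     <= (CP / n%:R)%R%:E)%E) ->
  exists N : nat, forall n : nat, (N <= n)%N ->
    (\int[lebesgue_measure]_(h0 in `[hl, hu])
       \int[lebesgue_measure]_(alpha in `[al, au])
         Eb P (fun w =>
           gibbs_k k (fun X => J n X w) (fun i => tau n alpha i w) h0 h1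
             (fun S => (Qk S -
                Er P (fun w' => gibbs_k k (fun X => J n X w')
                                   (fun i => tau n alpha i w') h0 h1 (@Qk R n k)))
                ^+ 2)%R)
    <= (4 * k%:R ^+ 2 / (tanhR h1) ^+ k * Num.sqrt (5 * CP + 40)
          / n%:R `^ ((theta - 1 / 2) / 3))%R%:E)%E.
Proof.
move=> /andP[theta_gt theta_le] hl0 hlu hu1 al0 alu au1 /andP[h10 h11] _ mJ J0 _ _
  mtau tau_law indep CP0 conc.
pose c1 : R := 4 / tanhR h1 ^+ k * Num.sqrt (5 * CP + 40).
have c10 : 0 < c1.
  rewrite mulr_gt0 ?sqrtr_gt0//; last by lra.
  by rewrite divr_gt0// exprn_gt0// tanhR_gt0.
pose c0 : R := 2 * expR 2 + 4 * CP + 8.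
have c00 : 0 <= c0 by rewrite !addr_ge0 ?mulr_ge0 ?expR_ge0// ltW.
(* Each summand secures one requirement on [y >= M]: [1 <= y], room for the field step through
   [hu + e < 1], and [c0 <= c1 * y]. *)
pose M : R := 1 + (1 - hu)^-1 + c0 / c1.
have hu1' : 0 < 1 - hu by rewrite subr_gt0.
have Ma : 0 < (1 - hu)^-1 by rewrite invr_gt0.
have Mb : 0 <= c0 / c1 by rewrite divr_ge0// ltW.
have M1 : 1 <= M by rewrite /M; lra.
exists (Num.truncn (M ^+ 8)).+1 => n nN.
have M8 : 0 <= M ^+ 8 by rewrite exprn_ge0// (le_trans ler01).
have nM : M ^+ 8 < n%:R.
  have /andP[_ H] := truncn_itv M8; apply: lt_le_trans H _.
  by rewrite ler_nat.
have n_gt0 : (0 < n)%N by apply: leq_trans nN.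
have nR0 : 0 < n%:R :> R by rewrite ltr0n.
pose y : R := n%:R `^ (1 / 8).
have y_ge0 : 0 <= y by exact: powR_ge0.
have yE : n%:R = y ^+ 8.
  by rewrite /y -powR_mulrn ?powR_ge0// -powRrM mul1r mulVf ?powRr1 ?ltW// pnatr_eq0.
have yM : M <= y.
  rewrite leNgt; apply/negP => yM.
  have : y ^+ 8 < M ^+ 8 by rewrite ltr_pXn2r// nnegrE// (le_trans ler01).
  by rewrite -yE; move: nM; lra.
have y1 : 1 <= y := le_trans M1 yM.
have y0 : 0 < y by exact: lt_le_trans y1.
pose e : R := (y ^+ 2)^-1.
have e0 : 0 < e by rewrite invr_gt0 exprn_gt0.
have hue : hu + e < 1.
  have : e < 1 - hu.
    rewrite -[1 - hu]invrK ltf_pV2 ?posrE ?exprn_gt0//.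
    apply: (@lt_le_trans _ _ y); first by apply: lt_le_trans yM; rewrite /M; lra.
    by rewrite expr2 ler_peMr// ltW.
  by lra.
(* With this width, [n ^ 2] cells make up exactly the long step [e], and [n * dl2 <= 1] keeps the
   exponential bounded. *)
pose dl2 : R := e / n%:R ^+ 2.
have dl20 : 0 < dl2 by rewrite divr_gt0// exprn_gt0.
(* Equal to [n ^ (-1/2)], the scale of the pressure fluctuations, at which [V / s] and [s] balance
   up to a constant. *)
pose s : R := e ^+ 2.
have s0 : 0 < s by rewrite exprn_gt0.
pose N := (Num.truncn ((hu - hl) / dl2)).+1.
have q0 : 0 <= (hu - hl) / dl2 by rewrite divr_ge0 ?subr_ge0// ltW.
have /andP[N1 N2] := truncn_itv q0.
have huN : hu < hl + N%:R * dl2 by rewrite -ltrBlDl -ltr_pdivrMr.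
have n1R : 1 <= n%:R :> R by rewrite ler1n.
have Ndl : N%:R * dl2 <= 2.
  have dle : dl2 <= 1.
    rewrite /dl2 ler_pdivrMr ?exprn_gt0// mul1r.
    apply: (@le_trans _ _ 1); last by rewrite exprn_ege1.
    by rewrite /e invf_le1 ?exprn_gt0// exprn_ege1.
  have -> : N%:R * dl2 = (Num.truncn ((hu - hl) / dl2))%:R * dl2 + dl2.
    by rewrite /N -natr1 mulrDl mul1r.
  by move: N1; rewrite ler_pdivlMr//; lra.
pose mm x h := mean_mag P (J n) (pos_part (tau n x)) h1 h.
have mp x i := measurable_pos_part (tau n x) (mtau n x) i.
have mm01 x h : 0 <= h -> 0 <= mm x h <= 1.
  exact: mean_mag_01 n_gt0 (ltW h10) (mJ n) (mp x) (J0 n) (pos_part_ge0 (tau n x)) h.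
have mm_incr x a b : a <= b -> mm x a <= mm x b.
  move=> ab; rewrite -[b](subrKC a).
  by apply: mean_mag_incr => //; rewrite subr_ge0.
pose cc : R := expR (2 * (n%:R * dl2)) / (n%:R * dl2).
pose a : R := (CP / n%:R / s + s) / e.
have cc0 : 0 <= cc by rewrite divr_ge0 ?expR_ge0// mulr_ge0// ltW.
have a0 : 0 <= a by apply/ltW/divr_gt0/e0/addr_gt0/s0/divr_gt0/s0/divr_gt0.
pose pt (j : nat) : R := hl + j%:R * dl2.
have pt0 j : 0 <= pt j by rewrite addr_ge0 ?mulr_ge0// ltW.
pose K := (n ^ 2)%N.
(* A field [h] is located only up to its cell, so [h] is bounded below by [pt j] and each shift of
   [h] costs one extra cell: [1 + 1] for [dl2] and [K + 1] for [e]. *)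
pose F (j : nat) (x : R) : R := k%:R ^+ 2 *
  (cc * (mm x (pt (j + 2)%N) - mm x (pt j)) +
   2 * (a + (mm x (pt (j + (K + 1))%N) - mm x (pt j)))).
have ptS j L : pt (j + L)%N = pt j + L%:R * dl2 by rewrite /pt natrD mulrDl addrA.
have cellS h j : h < hl + j.+1%:R * dl2 -> h < pt j + dl2.
  by rewrite /pt -natr1 mulrDl mul1r addrA.
have inc0 x j L : 0 <= mm x (pt (j + L)%N) - mm x (pt j).
  by rewrite subr_ge0 mm_incr// ptS lerDl mulr_ge0// ltW.
have Kdl : K%:R * dl2 = e.
  by rewrite /K natrX /dl2 mulrCA mulfV ?mulr1// expf_neq0// gt_eqF.
have := @iterated_integral_le R (fun h0 alpha => Eb P (fun w =>
           gibbs_k k (fun X => J n X w) (fun i => tau n alpha i w) h0 h1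
             (fun S => (Qk S -
                Er P (fun w' => gibbs_k k (fun X => J n X w')
                                   (fun i => tau n alpha i w') h0 h1 (@Qk R n k)))
                ^+ 2)%R)) F hl hu al au dl2
  (k%:R ^+ 2 * (cc * 2 + N%:R * (2 * a) + 2 * (n%:R ^+ 2 + 1))) N alu dl20 huN.
move=> bound; apply: le_trans (bound _ _ _ _ _) _ => {bound}.
- apply: mulr_ge0; first exact: exprn_ge0.
  apply: addr_ge0; first by apply: addr_ge0; apply: mulr_ge0 => //; exact: mulr_ge0.
  by apply: mulr_ge0 => //; apply: addr_ge0 => //; exact: exprn_ge0.
- move=> h x; apply: integral_ge0 => w _; rewrite lee_fin /gibbs_k divr_ge0//.
    rewrite sumr_ge0// => S _; rewrite mulr_ge0 ?sqr_ge0// prodr_ge0// => i _.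
    exact/ltW/gweight_gt0.
  rewrite exprn_ge0// sumr_ge0// => S _; exact/ltW/gweight_gt0.
- move=> j x; rewrite mulr_ge0 ?exprn_ge0// addr_ge0// mulr_ge0//.
  by rewrite addr_ge0.
- move=> x; rewrite -mulr_sumr ler_wpM2l ?exprn_ge0//.
  have s1 := sum_increments_le (fun j => mm x (pt j)) N 2 (fun j => mm01 x _ (pt0 j)).
  have s2 := sum_increments_le (fun j => mm x (pt j)) N (K + 1) (fun j => mm01 x _ (pt0 j)).
  rewrite big_split/= -!mulr_sumr -addrA lerD ?ler_wpM2l//.
  rewrite [N%:R * _]mulrCA -mulrDr ler_wpM2l// big_split/= sumr_const card_ord.
  rewrite -[a *+ N]mulr_natl lerD2l; apply: le_trans s2 _.
  by rewrite natrD natrX.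
- move=> h x j hj1 hj2 hhu /andP[xl xu].
  have hl_h : hl <= h by apply: le_trans hj1; rewrite lerDl mulr_ge0// ltW.
  have h0 : 0 <= h by apply: le_trans hl_h; exact: ltW.
  have x01 : 0 < x < 1 by apply/andP; split; lra.
  have rate0 : 0 < x * n%:R `^ (theta - 1).
    by rewrite mulr_gt0 ?powR_gt0//; have /andP[] := x01.
  have conc_h h' : h' = h \/ h' = h + e ->
      (Eb P (fun w => (pressure (fun X => J n X w) (fun i => tau n x i w) h' h1
        - Er P (fun w' => pressure (fun X => J n X w') (fun i => tau n x i w') h' h1))
       ^+ 2)%R <= (CP / n%:R)%:E)%E.
    by move=> hh'; apply: conc => //; case: hh' => ->; apply/andP; split; lra.
  apply: le_trans (overlap_deviation_bound P (J n) (tau n x) h1 _ n_gt0 (ltW h10) rate0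
    (mJ n) (mtau n x) (J0 n) (fun i m => tau_law n x i m n_gt0 x01) (indep n x n_gt0 x01)
    k h e dl2 s (CP / n%:R) h0 e0 dl20 s0 conc_h) _.
  have low : mm x (pt j) <= mm x h by exact: mm_incr.
  have up2 : mm x (h + dl2) <= mm x (pt (j + 2)%N).
    apply: mm_incr; rewrite ptS (_ : 2 * dl2 = dl2 + dl2) ?addrA ?lerD2r; last by ring.
    exact/ltW/cellS.
  have upK : mm x (h + e) <= mm x (pt (j + (K + 1))%N).
    apply: mm_incr; rewrite ptS natrD mulrDl Kdl mul1r [e + _]addrC addrA lerD2r.
    exact/ltW/cellS.
  rewrite lee_fin /F; apply: ler_wpM2l; first exact: exprn_ge0.
  apply: lerD; first exact: (ler_wpM2l cc0 (lerB up2 low)).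
  apply: ler_wpM2l => //; apply: lerD; first exact: lexx.
  exact: lerB upK low.
rewrite lee_fin.
rewrite [leRHS](_ : _ = k%:R ^+ 2 * c1 / n%:R `^ ((theta - 1 / 2) / 3)); last first.
  by rewrite /c1; ring.
apply: (final_scale y) => //.
- by rewrite subr_ge0.
- by lra.
- exact: powR_gt0.
- by apply: ler_powR => //; lra.
- rewrite -ler_pdivrMl// mulrC; apply: le_trans yM; rewrite /M -/c0; lra.
Qed.
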